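(* In the standing setting described in the context, for each $\alpha>0$ let $R_\alpha:\mathbb R\to(R_-,R_+)$ denote the IGR shock profile with inverse $R_\alpha^{-1}:(R_-,R_+)\to\mathbb R$. For any $\delta\in(0,(R_+-R_-)/2)$ define $$\xi_\alpha^-(\delta)=R_\alpha^{-1}(R_-+\delta),\qquad \xi_\alpha^+(\delta)=R_\alpha^{-1}(R_+-\delta).$$ Then $$\xi_\alpha^+(\delta)-\xi_\alpha^-(\delta)=\sqrt\alpha\,C_\delta$$ for a constant $C_\delta$ depending on $\delta$ but independent of $\alpha$. Thus the shock width scales like $\sqrt\alpha$.
   Context: Standing setting (all data below are independent of $\alpha$; $\alpha>0$ is a varying parameter). Fix a physical equation of state $\tilde p:(0,\infty)\times\mathbb R\to\mathbb R$, $(\rho,e)\mapsto\tilde p(\rho,e)$, of class $C^2$, real numbers $c,m,q,k$ with $m\neq0$, and end states $R_\pm>0$, $U_\pm,\mathcal E_\pm\in\mathbb R$. Put $e_\pm=\mathcal E_\pm/R_\pm-\frac12U_\pm^2$ and assume the Rankine–Hugoniot relations $R_\pm(U_\pm-c)=m$, $mU_\pm+\tilde p(R_\pm,e_\pm)=q$, $(\mathcal E_\pm+\tilde p(R_\pm,e_\pm))U_\pm-c\,\mathcal E_\pm=k$. For $R>0$ define $$e(R)=e_0+\frac{A}{R}+\frac{m^2}{2R^2},\quad e_0=\frac{k-qc+\frac m2c^2}{m},\quad A=mc-q,$$ the reduced pressure $p(R)=\tilde p(R,e(R))$, and $\mathcal S(R)=q-mc-\frac{m^2}{R}-p(R)$.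 (Then $e(R_\pm)=e_\pm$ and $\mathcal S(R_\pm)=0$.) Primes denote $d/dR$, dots denote $d/d\xi$. Assume: (1) $R_-<R_+$; (2) Lax inequalities: $U_--\sqrt{p'(R_-)}>c>U_+-\sqrt{p'(R_+)}$ (with $p'(R_\pm)\ge0$); equivalently $m>0$, $\frac{m^2}{R_-^2}-p'(R_-)>0$ and $\frac{m^2}{R_+^2}-p'(R_+)<0$; (3) $p\in C^2((0,\infty))$, and one of the following convexity criteria holds along $(\rho,e)=(R,e(R))$ for $R\in[R_-,R_+]$: (A) the matrix $\begin{pmatrix}\tilde p_{\rho\rho}+\frac{m^2}{R^4}\tilde p_e&\tilde p_{\rho e}-\frac1R\tilde p_e\\ \tilde p_{\rho e}-\frac1R\tilde p_e&\tilde p_{ee}\end{pmatrix}$ is positive semidefinite; or (B) $\tilde p_{\rho\rho}\ge0$, $\tilde p_{ee}\ge0$, $\tilde p_e\ge0$, $\tilde p_{\rho e}\ge\frac1R\tilde p_e$, $e'(R)\ge0$. In particular $p''(R)\ge0$, and this inequality is assumed for all $R>0$; (4) $p''$ is Lipschitz in a neighborhood of $R_s$, where the sonic density $R_s\in(R_-,R_+)$ is the unique zero of $\mathcal S'$ in $(0,\infty)$. For $\alpha>0$, the IGR shock profile $R_\alpha$ is the function, unique up to translation, $R:\mathbb R\to[R_-,R_+]$ that is nondecreasing, belongs to $W^{1,2}_{\mathrm{loc}}(\mathbb R)$, satisfies $R(\xi)\to R_\pm$ as $\xi\to\pm\infty$, and for every $\varphi\in C_c^\infty(\mathbb R)$ $$\int_{\mathbb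 R}\alpha\frac{\mathcal S'(R)}{R}\dot R\,\dot\varphi\,d\xi+\int_{\mathbb R}\Big(\frac{\mathcal S(R)}{R}-2\alpha\frac{m^2}{R^4}\dot R^2\Big)\varphi\,d\xi=0.$$ It exists, is continuous and strictly increasing, and is a bijection $\mathbb R\to(R_-,R_+)$. *)

(* Defs.v *)
From HB Require Import structures.
From mathcomp Require Import all_boot all_order all_algebra.
From mathcomp Require Import all_classical all_reals all_analysis.

Set Implicit Arguments.
Unset Strict Implicit.
Unset Printing Implicit Defensive.

Import Order.TTheory GRing.Theory Num.Theory.
Import numFieldNormedType.Exports.

Local Open Scope ring_scope.
Local Open Scope classical_set_scope.

Definition C2_on_line (R : realType) (D : set R) (f : R -> R) : Prop :=
  forall x, D x ->
    [/\ derivable f x 1, derivable (derive1 f) x 1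
      & {for x, continuous (derive1n 2 f)}].

(* Partial derivatives with respect to rho and e. *)
Definition partial1 (R : realType) (f : R * R -> R) : R * R -> R :=
  'D_((1, 0) : R * R) f.

Definition partial2 (R : realType) (f : R * R -> R) : R * R -> R :=
  'D_((0, 1) : R * R) f.

Definition C1_on_plane (R : realType) (D : set (R * R)) (f : R * R -> R) :
    Prop :=
  forall x, D x ->
    [/\ derivable f x (1, 0), derivable f x (0, 1),
        {for x, continuous (partial1 f)} & {for x, continuous (partial2 f)}].

Definition C2_on_plane (R : realType) (D : set (R * R)) (f : R * R -> R) :
    Prop :=
  [/\ C1_on_plane D f, C1_on_plane D (partial1 f) & C1_on_plane D (partial2 f)].

Definition test_function (R : realType) (phi : R -> R) : Prop :=
  (forall n x, derivable (derive1n n phi) x 1) /\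
  compact (closure [set x | phi x != 0]).

Definition L2loc (R : realType) (f : R -> R) : Prop :=
  measurable_fun setT f /\ locally_integrable setT (fun x => f x ^+ 2).

Definition weak_derivative (R : realType) (f g : R -> R) : Prop :=
  forall phi : R -> R, test_function phi ->
    \int[lebesgue_measure]_x (f x * derive1 phi x) =
    - \int[lebesgue_measure]_x (g x * phi x).

(* [f] belongs to W^{1,2}_loc, with weak derivative [g]. *)
Definition W12loc_with (R : realType) (f g : R -> R) : Prop :=
  [/\ L2loc f, L2loc g & weak_derivative f g].

(* A traveling wave of speed c in the variables (rho, u, E), E being the total *)
(* energy density; m, q and k are the constant mass, momentum and energy       *)
(* fluxes in the frame of the wave.  The suffixes m and p stand for the left   *)
(* (-) and right (+) end states.  The equation of state is a total function of *)
(* (rho, e); only its values at rho > 0 matter.                                *)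
Record shock_data (R : realType) := ShockData {
  eos : R * R -> R ;
  speed : R ;
  mflux : R ;
  qflux : R ;
  kflux : R ;
  Rm : R ;
  Rp : R ;
  Um : R ;
  Up : R ;
  Em : R ;
  Ep : R
}.

Section ShockData.
Context {R : realType} (d : shock_data R).

Local Notation c := (speed d).
Local Notation m := (mflux d).
Local Notation q := (qflux d).
Local Notation k := (kflux d).

Definition specific_energy (r u E : R) : R := E / r - u ^+ 2 / 2.

Definition rankine_hugoniot (r u E : R) : Prop :=
  let pr := eos d (r, specific_energy r u E) in
  [/\ r * (u - c) = m, m * u + pr = q & (E + pr) * u - c * E = k].

(* [energy r] is the specific internal energy at density r obtained by solving *)
(* the three flux identities for u and E: u = c + m / r, then                  *)
(* (E + p) u - c E = k with p = q - m u.                                       *)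
Definition e0 : R := (k - q * c + m / 2 * c ^+ 2) / m.

Definition Acoef : R := m * c - q.

Definition energy (r : R) : R := e0 + Acoef / r + m ^+ 2 / (2 * r ^+ 2).

Definition pressure (r : R) : R := eos d (r, energy r).

(* The defect in the momentum identity m u + p = q along u = c + m / r. *)
Definition calS (r : R) : R := q - m * c - m ^+ 2 / r - pressure r.

Definition lax_inequalities : Prop :=
  [/\ 0 <= derive1 pressure (Rm d), 0 <= derive1 pressure (Rp d),
      Um d - Num.sqrt (derive1 pressure (Rm d)) > c &
      c > Up d - Num.sqrt (derive1 pressure (Rp d))].

Definition eos_e (r : R) : R := partial2 (eos d) (r, energy r).
Definition eos_rr (r : R) : R := partial1 (partial1 (eos d)) (r, energy r).
Definition eos_re (r : R) : R := partial2 (partial1 (eos d)) (r, energy r).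
Definition eos_ee (r : R) : R := partial2 (partial2 (eos d)) (r, energy r).

Definition positive_semidefinite (n : nat) (M : 'M[R]_n) : Prop :=
  M^T = M /\ forall v : 'cV[R]_n, 0 <= (v^T *m M *m v) 0 0.

(* Along e = energy r one has energy'' = - (2 / r) energy' + m^2 / r^4, so that *)
(* the value at (1, energy' r) of the quadratic form of this matrix is          *)
(* pressure'' r.                                                                *)
Definition convexity_matrix (r : R) : 'M[R]_(1 + 1) :=
  block_mx (eos_rr r + m ^+ 2 / r ^+ 4 * eos_e r)%:M
           (eos_re r - r^-1 * eos_e r)%:M
           (eos_re r - r^-1 * eos_e r)%:M
           (eos_ee r)%:M.

Definition convexity_A : Prop :=
  forall r, Rm d <= r <= Rp d -> positive_semidefinite (convexity_matrix r).

Definition convexity_B : Prop :=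
  forall r, Rm d <= r <= Rp d ->
    [/\ 0 <= eos_rr r, 0 <= eos_ee r, 0 <= eos_e r, r^-1 * eos_e r <= eos_re r
      & 0 <= derive1 energy r].

Definition sonic_density (Rs : R) : Prop :=
  Rm d < Rs < Rp d /\ forall r, 0 < r -> (derive1 calS r = 0 <-> r = Rs).

Definition lipschitz_near (f : R -> R) (x : R) : Prop :=
  exists K : R, exists2 V : set R, nbhs x V & K.-lipschitz_V f.

Definition weak_profile_equation (alpha : R) (f g : R -> R) : Prop :=
  forall phi : R -> R, test_function phi ->
    \int[lebesgue_measure]_x
        (alpha * (derive1 calS (f x) / f x) * g x * derive1 phi x) +
    \int[lebesgue_measure]_x
        ((calS (f x) / f x - 2 * alpha * (m ^+ 2 / f x ^+ 4) * g x ^+ 2)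
           * phi x) = 0.

(* The weak derivative is unique a.e., so the choice of g is immaterial.  The   *)
(* profile is unique only up to translation, hence a predicate.                 *)
Definition IGR_profile (alpha : R) (f : R -> R) : Prop :=
  [/\ forall x, Rm d <= f x <= Rp d,
      {homo f : x y / x <= y},
      f x @[x --> -oo] --> Rm d,
      f x @[x --> +oo] --> Rp d &
      exists2 g, W12loc_with f g & weak_profile_equation alpha f g].

End ShockData.

(* ['pinv_(fun=> 0) setT f y] is a preimage of [y] under [f] when there is     *)
(* one, and 0 otherwise; for a profile and y strictly between the end states   *)
(* this is the usual inverse, as profiles are bijections onto ]Rm, Rp[.        *)
Definition profile_inverse (R : realType) (f : R -> R) : R -> R :=
  'pinv_(fun=> 0) setT f.

Definition xi_minus (R : realType) (d : shock_data R) (f : R -> R) (delta : R) :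
  R := profile_inverse f (Rm d + delta).

Definition xi_plus (R : realType) (d : shock_data R) (f : R -> R) (delta : R) :
  R := profile_inverse f (Rp d - delta).

(* Main.v *)
(** Where f is away from the sonic value Rs, the weak equation says that f and
    the flux W = alpha S'(f)/f f' solve a first order system.  With the density r
    as independent variable, the energy V = W^2/alpha satisfies the alpha-free
    linear equation
      V' = 2 S S'/r^2 - 4 m^2 V/(r^3 S'),
    and V -> 0 at both end states.  The difference of two solutions has a square
    which is monotone on each side of Rs, hence it vanishes: V does not depend
    on the profile.  The inverse X of f has X' = alpha S'/(W r), so that
    X'/sqrt alpha is the same for all profiles away from Rs; X being continuous
    at Rs, so are the increments of X/sqrt alpha.  Thus C is read off any one
    profile, and existence of profiles is not used (C = 1 if there is none).
    Test functions built from exp(-1/x) turn the weak identities into integral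
    ones at Lebesgue points, which gives the regularity of f and W. *)
Require Import Defs.
From HB Require Import structures.
From mathcomp Require Import all_boot all_order all_algebra.
From mathcomp Require Import all_classical all_reals all_analysis.
From mathcomp Require Import measurable_realfun.
From mathcomp Require Import ring lra.

Set Implicit Arguments.
Unset Strict Implicit.
Unset Printing Implicit Defensive.

Import Order.TTheory GRing.Theory Num.Theory.
Import numFieldNormedType.Exports.

Local Open Scope ring_scope.
Local Open Scope classical_set_scope.

(** * A smooth step function *)

Section Smooth.
Context {R : realType}.
Implicit Types (f g : R -> R) (x : R).

(** The obstacle is the sonic density: where f = Rs the factor S'(f) vanishes, the first order
    system degenerates, and nothing is known about f' there. No estimate is therefore carried across
    this level. The equation for V is singular at Rs, but its coefficient changes sign in the
    favourable way: for the difference D of two solutions, (D^2)' = -8 m^2 D^2/(r^3 S'), so D^2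
    decreases away from R- up to Rs and increases from Rs towards R+, and each side is controlled by
    its own end state. Dividing W^2 by alpha removes alpha because dV/dr = (2 W/alpha) W' X' with X'
    = alpha S'/(W r). The sign of W, lost in V, comes back from the monotonicity of f: W and S' have
    the same sign. Two facts are then needed about the level Rs itself: f takes this value at most
    once, and X is continuous there. *)

Definition smooth f := forall n x, derivable (derive1n n f) x 1.

(* [Cn n f] gives [f] derivatives up to order [n + 1]. *)
Fixpoint Cn n f : Prop :=
  (forall x, derivable f x 1) /\ (if n is n'.+1 then Cn n' f^`() else True).

(** [Cn] recurses through the derivative of its argument, so the sum, product and inverse rules can
    be iterated by induction on the order; [smooth] is the form that [test_function] asks for. *)
Lemma smoothP f : smooth f <-> forall n, Cn n f.
Proof.
split.
- move=> sf n; elim: n f sf => [|n IHn] f sf /=.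
    by split => // x; exact: (sf 0%N x).
  split=> [x|]; first exact: (sf 0%N x).
  by apply: IHn => k x; rewrite -derive1Sn; exact: sf.
- move=> cf n; elim: n f cf => [|n IHn] f cf x; first by case: (cf 0%N).
  by rewrite derive1Sn; apply: IHn => k; case: (cf k.+1).
Qed.

Lemma CnS n f : Cn n.+1 f -> Cn n f.
Proof.
by elim: n f => [|n IHn] f /= [df cf]; split => //; apply: IHn.
Qed.

Lemma derive1_ext f df : (forall x, is_derive x 1 f (df x)) -> f^`() = df.
Proof. by move=> H; apply/funext => x; rewrite derive1E derive_val. Qed.

Lemma CnD n f g : Cn n f -> Cn n g -> Cn n (f \+ g).
Proof.
elim: n f g => [|n IHn] f g /= [df cf] [dg cg].
  by split=> [x|]; [exact: derivableD|exact: I].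
split; first by move=> x; exact: derivableD.
rewrite (_ : (f \+ g)^`() = f^`() \+ g^`()); first exact: IHn.
by apply/funext => x /=; rewrite !derive1E deriveD.
Qed.

Lemma CnN n f : Cn n f -> Cn n (\- f).
Proof.
elim: n f => [|n IHn] f /= [df cf].
  by split=> [x|]; [exact: derivableN|exact: I].
split; first by move=> x; exact: derivableN.
rewrite (_ : (\- f)^`() = \- f^`()); first exact: IHn.
by apply/funext => x /=; rewrite !derive1E deriveN.
Qed.

Lemma CnM n f g : Cn n f -> Cn n g -> Cn n (f \* g).
Proof.
elim: n f g => [|n IHn] f g.
  by move=> [df cf] [dg cg]; split=> [x|]; [exact: derivableM|exact: I].
move=> cf cg; have [df cdf] := cf; have [dg cdg] := cg.
split; first by move=> x; exact: derivableM.
rewrite (_ : (f \* g)^`() = (f \* g^`()) \+ (g \* f^`())).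
  by apply: CnD; apply: IHn => //; exact: CnS.
by apply/funext => x /=; rewrite !derive1E deriveM.
Qed.

Lemma CnV n f : (forall x, f x != 0) -> Cn n f -> Cn n (fun x => (f x)^-1).
Proof.
move=> f0; elim: n => [|n IHn].
  by move=> [df cf]; split=> [x|]; [exact: derivableV|exact: I].
move=> cf; have [df cdf] := cf.
split; first by move=> x; exact: derivableV.
rewrite (_ : _^`() = \- ((fun x => (f x)^-1) \* ((fun x =>
  (f x)^-1) \* f^`()))).
  by apply/CnN/CnM/CnM => //; apply/IHn/CnS.
apply/funext => x /=; rewrite !derive1E deriveV//.
by rewrite /GRing.scale /= mulNr -exprVn expr2 mulrA.
Qed.

Lemma is_derive_affine f (a b x df : R) : is_derive (a * x + b) 1 f df ->
  is_derive x 1 (fun y => f (a * y + b)) (a * df).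
Proof.
move=> Hf.
have Hg : is_derive x 1 (fun y => a * y + b) a.
  rewrite [X in is_derive _ _ X _](_ : _ = (a \*: id) + cst b) //.
  by apply: is_derive_eq; rewrite /GRing.scale /= mulr1 addr0.
rewrite mulrC; exact: (@is_derive1_comp _ f _ x _ _ Hf Hg).
Qed.

Lemma Cn_cst n (a : R) : Cn n (cst a).
Proof.
elim: n a => [|n IHn] a.
  by split=> [x|]; [exact: derivable_cst|exact: I].
split; first by move=> x; exact: derivable_cst.
by rewrite (@derive1_ext _ (cst 0)).
Qed.

Lemma Cn_affine n f (a b : R) : Cn n f -> Cn n (fun x => f (a * x + b)).
Proof.
elim: n f => [|n IHn] f [df cf];
  have H x : is_derive x 1 (fun y =>
    f (a * y + b)) (a * derive1 f (a * x + b)) by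
    apply: is_derive_affine; rewrite derive1E; exact/derivableP.
  by split=> [x|]; [have [] := H x|exact: I].
split=> [x|]; first by have [] := H x.
rewrite (derive1_ext H).
by apply: (@CnM n (cst a) (fun x => derive1 f (a * x + b)) (Cn_cst n a));
  exact: IHn.
Qed.

Lemma smooth_affine f (a b : R) : smooth f -> smooth (fun x => f (a * x + b)).
Proof. by move=> /smoothP sf; apply/smoothP => n; exact: Cn_affine. Qed.

Lemma smoothD f g : smooth f -> smooth g -> smooth (f \+ g).
Proof.
by move=> /smoothP sf /smoothP sg; apply/smoothP => n; exact: CnD.
Qed.

Lemma smoothN f : smooth f -> smooth (\- f).
Proof. by move=> /smoothP sf; apply/smoothP => n; exact: CnN. Qed.

Lemma smoothM f g : smooth f -> smooth g -> smooth (f \* g).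
Proof.
by move=> /smoothP sf /smoothP sg; apply/smoothP => n; exact: CnM.
Qed.

Lemma smoothV f : (forall x, f x != 0) -> smooth f ->
  smooth (fun x => (f x)^-1).
Proof. by move=> f0 /smoothP sf; apply/smoothP => n; exact: CnV. Qed.

End Smooth.


(** * Functions p(1/x) exp(-1/x), extended by 0 to x <= 0 *)

Section Flat.
Context {R : realType}.
Implicit Types (f g : R -> R) (x : R) (p : {poly R}).

(** Each monomial satisfies y^n e^(-y) <= n!, since y^n/n! is a term of the exponential series;
    these bounds are summed with the weights |p_i|. *)
Lemma horner_expRN_bounded p :
  exists C, forall y : R, 0 <= y -> `|p.[y]| * expR (- y) <= C.
Proof.
have Hn n (y : R) : 0 <= y -> y ^+ n * expR (- y) <= n`!%:R.
  move=> y0; rewrite expRN ler_pdivrMr ?expR_gt0//.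
  case: n => [|n]; first by rewrite expr0 mul1r -expR0 ler_expR.
  have := expR_ge1Dxn n y0; have n0 : (0 : R) < (n.+1)`!%:R by
    rewrite ltr0n fact_gt0.
  move=> H; rewrite mulrC -ler_pdivrMr//; apply: le_trans H.
  by rewrite lerDr.
exists (\sum_(i < size p) `|p`_i| * (i`!)%:R) => y y0.
rewrite horner_coef.
apply: (@le_trans _ _ (\sum_(i < size p) `|p`_i| * (y ^+ i * expR (- y)))).
  rewrite [leRHS](eq_bigr (fun i : 'I_(size p) =>
    (`|p`_i| * y ^+ i) * expR (- y))); last first.
    by move=> i _; rewrite mulrA.
  rewrite -mulr_suml ler_pM2r ?expR_gt0//.
  apply: le_trans (ler_norm_sum _ _ _) _; apply: ler_sum => i _.
  by rewrite normrM (ger0_norm (exprn_ge0 _ y0)).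
by apply: ler_sum => i _; apply: ler_wpM2l => //; exact: Hn.
Qed.

(** The polynomial makes the family closed under differentiation: p becomes X^2 (p - p'). Smoothness
    to all orders then follows from a single computation of the derivative. *)
Definition flat p x := if 0 < x then p.[x^-1] * expR (- x^-1) else 0.

(** Boundedness of y^2 p(y) e^(-y) read at y = 1/x. The quadratic bound settles the derivative at 0,
    the one point where the usual rules do not apply. *)
Lemma flat_le_sqr p : exists C, forall x, `|flat p x| <= C * x ^+ 2.
Proof.
have [C HC] := horner_expRN_bounded (p * 'X^2).
have C0 : 0 <= C by apply: le_trans (HC 0 (lexx _)); rewrite mulr_ge0 ?expR_ge0.
exists C => x; rewrite /flat; case: ifPn => [x0|_]; last first.
  by rewrite normr0 mulr_ge0 ?sqr_ge0.
have xV0 : 0 < x^-1 by rewrite invr_gt0.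
have := HC _ (ltW xV0).
rewrite hornerM hornerXn normrM (ger0_norm (exprn_ge0 _ (ltW xV0))) exprVn.
rewrite normrM (ger0_norm (expR_ge0 _)) mulrAC ler_pdivrMr//.
exact: exprn_gt0.
Qed.

Lemma is_derive_le_sqr f (C : R) :
  (forall x, `|f x| <= C * x ^+ 2) -> is_derive (0 : R) 1 f 0.
Proof.
move=> Hf.
have f0 : f 0 = 0.
  by apply/eqP; rewrite -normr_le0 (le_trans (Hf 0))// expr2 mulr0 mulr0.
(* Division by zero gives 0, so this quotient already takes at 0 the value 0 of the derivative. *)
apply/is_derive1_caratheodory; exists (fun z => f z / z).
have C0 : 0 <= C by have := le_trans (normr_ge0 _) (Hf 1); rewrite expr1n mulr1.
split; last by rewrite f0 mul0r.
- move=> z; rewrite f0 !subr0.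
  by have [->|z0] := eqVneq z 0; rewrite ?f0 ?mulr0// divfK.
- apply/cvgrPdist_le => /= e e0.
  have C1 : 0 < C + 1 by rewrite ltr_wpDl.
  have eC : 0 < e / (C + 1) by exact: divr_gt0.
  near=> z; rewrite f0 mul0r.
  rewrite sub0r normrN.
  apply: (@le_trans _ _ (C * `|z|)).
    have [->|z0] := eqVneq z 0; first by rewrite f0 mul0r normr0 mulr0.
    rewrite normrM normfV ler_pdivrMr ?normr_gt0//.
    by rewrite (le_trans (Hf z))// -mulrA -expr2 real_normK// num_real.
  apply: (@le_trans _ _ ((C + 1) * `|z|)); first by rewrite ler_wpM2r// lerDl.
  rewrite mulrC -ler_pdivlMr//.
Unshelve. all: by end_near. Qed.

Lemma is_derive_flat p x : is_derive x 1 (flat p) (flat ('X^2 * (p - p^`())) x).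
Proof.
have [x0|x0|->] := ltgtP x 0.
- rewrite {2}/flat (lt_gtF x0).
  apply: (@near_eq_is_derive _ _ _ (cst 0)).
  near=> y; rewrite /flat lt_gtF//; near: y.
  exact: lt_nbhsl.
- rewrite {2}/flat x0.
  apply: (@near_eq_is_derive _ _ _
    ((horner p \o (fun y : R => y^-1)) * (expR \o (fun y : R => - y^-1)))).
    near=> y; rewrite /flat (_ : 0 < y)//; near: y.
    exact: lt_nbhsr.
  have dV : is_derive x 1 (fun y : R => y^-1) (- x ^- 2).
    apply: is_derive_eq; first by apply: is_deriveV; rewrite gt_eqF.
    by rewrite /GRing.scale /= mulr1.
  have d1 := @is_derive1_comp _ (horner p) _ x _ _ (is_derive_poly p x^-1) dV.
  have d2 := @is_derive1_comp _ expR (fun y => - y^-1) x _ _ (is_derive_expR _)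
     (is_deriveN dV).
  apply: (is_derive_eq (is_deriveM d1 d2)).
  rewrite /= /GRing.scale /= hornerM hornerXn hornerD hornerN.
  rewrite exprVn; ring.
- rewrite {2}/flat ltxx; have [C HC] := flat_le_sqr p;
  exact: is_derive_le_sqr HC.
Unshelve. all: by end_near. Qed.

Lemma smooth_flat p : smooth (flat p).
Proof.
apply/smoothP => n; elim: n p => [|n IHn] p.
  by split=> [x|]; [have [] := is_derive_flat p x|exact: I].
split=> [x|]; first by have [] := is_derive_flat p x.
by rewrite (derive1_ext (is_derive_flat p)).
Qed.

End Flat.

(** * A smooth step and the test functions built from it *)

Section Step.
Context {R : realType}.
Implicit Types (x : R).

Lemma flat1_ge0 x : 0 <= flat 1 x.
Proof. by rewrite /flat; case: ifP => // _; rewrite hornerC mul1r expR_ge0. Qed.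

Lemma flat1_gt0 x : (0 < flat 1 x) = (0 < x).
Proof.
by rewrite /flat; case: ifP => // _; rewrite ?ltxx// hornerC mul1r expR_gt0.
Qed.

Lemma flat1_le0 x : x <= 0 -> flat 1 x = 0.
Proof. by rewrite /flat leNgt; case: ifP. Qed.

(** The factors [1 *] and [-1 *] fit the form of [smooth_affine]. One of x + 1 and 1 - x is always
    positive, so the denominator never vanishes. *)
Definition step x : R :=
  flat 1 (1 * x + 1) * (flat 1 (1 * x + 1) + flat 1 (-1 * x + 1))^-1.

Lemma step_den_gt0 x : 0 < flat 1 (1 * x + 1) + flat 1 (-1 * x + 1).
Proof.
have [x0|x0] := lerP 0 x.
  by rewrite ltr_pwDl ?flat1_ge0// flat1_gt0; lra.
by rewrite ltr_wpDl ?flat1_ge0// flat1_gt0; lra.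
Qed.

Lemma smooth_step : smooth step.
Proof.
apply: (@smoothM _ (fun x => flat 1 (1 * x + 1))
  (fun x => (flat 1 (1 * x + 1) + flat 1 (-1 * x + 1))^-1)).
  exact/smooth_affine/smooth_flat.
apply: smoothV; first by move=> x; rewrite gt_eqF ?step_den_gt0.
by apply: (@smoothD _ (fun x => flat 1 (1 * x + 1)) (fun x =>
  flat 1 (-1 * x + 1)));
  exact/smooth_affine/smooth_flat.
Qed.

Lemma step_leN1 x : x <= -1 -> step x = 0.
Proof. by move=> x1; rewrite /step flat1_le0 ?mul0r//; lra. Qed.

Lemma step_ge1 x : 1 <= x -> step x = 1.
Proof.
move=> x1; rewrite /step (@flat1_le0 (-1 * x + 1)) ?addr0; last lra.
by rewrite divff// gt_eqF// flat1_gt0; lra.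
Qed.

Lemma step_itv x : 0 <= step x <= 1.
Proof.
rewrite /step divr_ge0 ?flat1_ge0//=; last exact/ltW/step_den_gt0.
by rewrite -[leRHS](divff (x := flat 1 (1 * x + 1) + flat 1
  (-1 * x + 1))) ?gt_eqF ?step_den_gt0// ler_pM2r ?invr_gt0 ?step_den_gt0//
  lerDl flat1_ge0.
Qed.

Lemma derive1_step_eq0 x : 1 < `|x| -> derive1 step x = 0.
Proof.
have near_cst (c : R) : (\near x, step x = c) -> derive1 step x = 0.
  move=> H; rewrite derive1E (@near_eq_derive _ _ _ _ (cst c))//.
  exact: derive_cst.
rewrite lter_normr => /orP[x1|x1].
- apply: (@near_cst 1); near=> y; rewrite step_ge1//; near: y.
  by apply: filterS (lt_nbhsr x1) => y /ltW.
- have x1' : x < -1 by lra.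
  apply: (@near_cst 0); near=> y; rewrite step_leN1//; near: y.
  by apply: filterS (lt_nbhsl x1') => y /ltW.
Unshelve. all: by end_near. Qed.

Lemma smooth_continuous (f : R -> R) : smooth f -> continuous f.
Proof.
move=> sf x; apply/differentiable_continuous/derivable1_diffP.
exact: (sf 0%N x).
Qed.

Lemma smooth_derive1 (f : R -> R) : smooth f -> smooth (derive1 f).
Proof. by move=> sf n x; rewrite -derive1Sn; exact: sf. Qed.

Lemma derive1_step_bounded : exists M, forall x, `|derive1 step x| <= M.
Proof.
have cn : {within `[-1, 1], continuous (fun x => `|derive1 step x|)}.
  apply: continuous_subspaceT => x.
  apply: (@continuous_comp _ _ _ (derive1 step) (fun y => `|y|)).
    exact: smooth_continuous (smooth_derive1 smooth_step) x.
  exact: norm_continuous.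
have N11 : -1 <= 1 :> R by lra.
have [c _ Hc] := EVT_max N11 cn.
exists `|derive1 step c| => x.
have [x1|x1] := ltP 1 `|x|; first by rewrite derive1_step_eq0 ?normr0.
by apply: Hc; rewrite in_itv/= -ler_norml.
Qed.

(** A Heaviside function at [a] smoothed over [a - e, a + e]. The difference of two of these is a
    test function close to the indicator of an interval. *)
Definition bump_step (a e : R) x := step (e^-1 * x + - (e^-1 * a)).

Lemma bump_stepE a e x : bump_step a e x = step ((x - a) / e).
Proof. by rewrite /bump_step mulrBl mulrC (mulrC e^-1). Qed.

Lemma is_derive_bump_step a e x :
  is_derive x 1 (bump_step a e) (e^-1 * derive1 step ((x - a) / e)).
Proof.
rewrite mulrBl [x / e]mulrC [a / e]mulrC.
apply: is_derive_affine; rewrite derive1E; apply/derivableP.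
by have /smoothP/(_ 0%N)[] := smooth_step.
Qed.

Lemma test_function_bump_step (a b e : R) : 0 < e -> a <= b ->
  test_function (bump_step a e \- bump_step b e).
Proof.
move=> e0 ab; split.
  by apply/smoothD/smoothN; apply/smooth_affine/smooth_step.
apply: (@subclosed_compact _ _ `[a - e, b + e]); first exact: closed_closure.
  exact: segment_compact.
rewrite [X in _ `<=` X](closure_id _).1; last exact: itv_closed.
apply: closure_subset => x /=; rewrite !bump_stepE in_itv/=; apply: contraNT.
rewrite negb_and -!ltNge => /orP[xa|xb].
  by rewrite !step_leN1 ?subrr// ler_pdivrMr//; lra.
by rewrite !step_ge1 ?subrr// ler_pdivlMr//; lra.
Qed.

End Step.

(** * Weak derivatives on the line *)

Section WeakDerivative.
Context {R : realType}.
Notation mu := (@lebesgue_measure R).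
Implicit Types (h k psi : R -> R) (a b e r : R).

Lemma integrable_mul_bounded (D : set R) h psi (M : R) : measurable D ->
  mu.-integrable D (EFin \o h) -> measurable_fun setT psi ->
  (forall x, `|psi x| <= M) -> mu.-integrable D (EFin \o (h \* psi)).
Proof.
move=> mD ih mpsi psiM.
apply: (@integrableMl _ _ _ mu D mD (EFin \o h) psi ih).
  exact: measurable_funTS.
exists M; split; first exact: num_real.
by move=> y My x _ /=; apply: le_trans (ltW My).
Qed.

Lemma locally_integrable_compact h (K : set R) :
  locally_integrable setT h -> compact K -> mu.-integrable K (EFin \o h).
Proof.
move=> [mh _ ih] cK; apply/integrableP; split; last exact: ih.
by apply/measurable_EFinP; exact: measurable_funTS.
Qed.

Lemma locally_integrable_ball h a r :
  locally_integrable setT h -> mu.-integrable (ball a r) (EFin \o h).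
Proof.
move=> lh; apply: (@integrableS _ _ _ mu `[a - r, a + r]) => //.
- exact: measurable_ball.
- by rewrite ball_itv; apply: subset_itv_oo_cc.
- by apply: locally_integrable_compact => //; exact: segment_compact.
Qed.

Lemma continuous_locally_integrable h :
  continuous h -> locally_integrable setT h.
Proof.
move=> ch; split; [exact: continuous_measurable_fun|exact: openT|move=> K _ cK].
have /integrableP[_] : mu.-integrable K (EFin \o h).
  by apply: continuous_compact_integrable => //; exact/continuous_subspaceT.
by [].
Qed.

(** [davg] divides by the measure 2r of the ball. Multiplying back gives the integral that will be
    compared with a mollification at a Lebesgue point. *)
Lemma integral_davg h a r : 0 < r -> locally_integrable setT h ->
  \int[mu]_(y in ball a r) `|h y - h a| = r *+ 2 * fine (davg h a r).
Proof.
move=> r0 lh; rewrite /davg /iavg lebesgue_measure_ball ?ltW//.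
have r2 : r *+ 2 != 0 by rewrite mulrn_eq0/= gt_eqF.
have ic : mu.-integrable (ball a r) (EFin \o (fun y => h y - h a)).
  rewrite (_ : EFin \o _ = (EFin \o h) \- (EFin \o cst (h a)))%E; last first.
    by apply/funext => y /=; rewrite EFinB.
  apply: integrableB => //; [exact: measurable_ball|exact:
    locally_integrable_ball|].
  by apply/locally_integrable_ball/continuous_locally_integrable => ?;
    exact: cvg_cst.
rewrite inver (negPf r2) fineM//; last first.
  apply: integrable_fin_num; first exact: measurable_ball.
  exact: integrable_norm ic.
by rewrite /= mulrA divff// mul1r.
Qed.

Definition bump a e := fun x : R => e^-1 * derive1 step ((x - a) / e).

Lemma continuous_bump a e : continuous (bump a e).
Proof.
have -> : bump a e = derive1 (bump_step a e).
  by rewrite (derive1_ext (is_derive_bump_step a e)).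
exact/smooth_continuous/smooth_derive1/smooth_affine/smooth_step.
Qed.

Lemma measurable_bump a e : measurable_fun setT (bump a e).
Proof. by apply: continuous_measurable_fun; exact: continuous_bump. Qed.

Lemma bump_eq0 a e x : 0 < e -> e < `|x - a| -> bump a e x = 0.
Proof.
move=> e0 ex; rewrite /bump derive1_step_eq0 ?mulr0//.
by rewrite normrM normfV (gtr0_norm e0) ltr_pdivlMr// mul1r.
Qed.

Lemma Rintegral_bump a e r : 0 < e -> e < r ->
  \int[mu]_(x in ball a r) bump a e x = 1.
Proof.
move=> e0 er; rewrite ball_itv.
have r0 : 0 < r by exact: lt_trans er.
have lb : locally_integrable setT (bump a e).
  exact/continuous_locally_integrable/continuous_bump.
have ib : mu.-integrable `[a - r, a + r] (EFin \o bump a e).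
  by apply: locally_integrable_compact => //; exact: segment_compact.
rewrite Rintegral_itv_bndo_bndc; last first.
  by apply: (integrableS _ _ _ ib) => //; exact: subset_itv_oo_cc.
rewrite Rintegral_itv_obnd_cbnd; last first.
  by apply: (integrableS _ _ _ ib) => //; exact: subset_itv_oc_cc.
have cs : continuous (bump_step a e).
  exact/smooth_continuous/smooth_affine/smooth_step.
rewrite /Rintegral (@continuous_FTC2 _ (bump a e) (bump_step a e)); first last.
- by move=> x _; rewrite (derive1_ext (is_derive_bump_step a e)).
- split=> [x _||]; first by have [] := is_derive_bump_step a e x.
  + by apply: cvg_at_right_filter; exact: cs.
  + by apply: cvg_at_left_filter; exact: cs.
- exact/continuous_subspaceT/continuous_bump.
- lra.
rewrite /= !bump_stepE step_ge1; last by rewrite ler_pdivlMr//; lra.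
by rewrite step_leN1 ?subr0// ler_pdivrMr//; lra.
Qed.

Lemma Rintegral_mul_bump h a e r : 0 < e -> e < r ->
  \int[mu]_x (h x * bump a e x) = \int[mu]_(x in ball a r) (h x * bump a e x).
Proof.
move=> e0 er; rewrite [RHS]Rintegral_mkcond; congr Rintegral.
apply/funext => x; rewrite patchE; case: ifPn => //.
rewrite notin_setE /ball/= => /negP; rewrite -leNgt => rx.
by rewrite bump_eq0 ?mulr0// distrC (lt_le_trans er).
Qed.

(** As [bump a e] has mass 1, the difference is the integral of (h - h a) times the bump. The bump
    is at most M/e, and the ball of radius 2e, taken larger than the support, has measure 4e: hence
    the constant 4 M. *)
Lemma Rintegral_bump_dist h a e (M : R) : 0 < e ->
  (forall x, `|derive1 step x| <= M) -> locally_integrable setT h ->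
  `|\int[mu]_x (h x * bump a e x) - h a| <= 4 * M * fine (davg h a (e *+ 2)).
Proof.
move=> e0 HM lh.
have e2 : e < e *+ 2 by rewrite mulr2n ltrDl.
have e20 : 0 < e *+ 2 by exact: lt_trans e2.
have mB := @measurable_ball R a (e *+ 2).
have ih := @locally_integrable_ball h a (e *+ 2) lh.
have bM x : `|bump a e x| <= e^-1 * M.
  by rewrite normrM gtr0_norm ?invr_gt0// ler_wpM2l// invr_ge0 ltW.
have mb := @measurable_bump a e.
have ic (c : R) : mu.-integrable (ball a (e *+ 2)) (EFin \o cst c).
  by apply/locally_integrable_ball/continuous_locally_integrable => ?;
    exact: cvg_cst.
have icb (c : R) := integrable_mul_bounded mB (ic c) mb bM.
have ihb := integrable_mul_bounded mB ih mb bM.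
have ihc : mu.-integrable (ball a (e *+ 2)) (EFin \o (fun y => h y - h a)).
  rewrite (_ : EFin \o _ = (EFin \o h) \- (EFin \o cst (h a)))%E; last first.
    by apply/funext => y /=; rewrite EFinB.
  exact: integrableB.
have ihcb := integrable_mul_bounded mB ihc mb bM.
rewrite (Rintegral_mul_bump h a e0 e2).
have {1}-> : h a = \int[mu]_(x in ball a (e *+ 2)) (cst (h a) x * bump a e x).
  rewrite RintegralZl// ?(Rintegral_bump a e0 e2) ?mulr1//.
  have := icb 1; congr (mu.-integrable _ _).
  by apply/funext => x /=; rewrite mul1r.
rewrite -RintegralB//; last exact: icb.
under eq_Rintegral do rewrite -mulrBl.
apply: le_trans.
  by apply: le_normr_Rintegral; [exact: mB|exact: ihcb].
apply: (@le_trans _ _ (\int[mu]_(x in ball a (e *+ 2))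
  ((e^-1 * M) * `|h x - h a|))).
  apply: le_Rintegral => //.
  - exact: integrable_norm ihcb.
  - exact: (@integrableZl _ _ _ mu _ mB (e^-1 * M) _ (integrable_norm ihc)).
  - by move=> x _ /=; rewrite normrM mulrC ler_wpM2r.
rewrite RintegralZl//; last exact: integrable_norm ihc.
rewrite integral_davg// le_eqVlt; apply/orP; left; apply/eqP.
by rewrite mulrA; congr (_ * _); field; rewrite gt_eqF.
Qed.

Lemma cvg_Rintegral_bump h a (e_ : nat -> R) : locally_integrable setT h ->
  lebesgue_pt h a -> (forall n, 0 < e_ n) -> e_ n @[n --> \oo] --> 0 ->
  \int[mu]_x (h x * bump a (e_ n) x) @[n --> \oo] --> h a.
Proof.
move=> lh ha e0 ec.
have [M HM] := @derive1_step_bounded R.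
have dc : davg h a (e_ n *+ 2) @[n --> \oo] --> (0 : \bar R)%E.
  apply: ((@cvge_at_rightP R (davg h a) 0 0).1 ha (fun n => e_ n *+ 2)).
  split; first by move=> n; rewrite pmulrn_rgt0.
  by rewrite -(mul0rn _ 2); exact: cvgMn.
have {}dc : 4 * M * fine (davg h a (e_ n *+ 2)) @[n --> \oo] --> (0 : R).
  rewrite -[X in _ --> X](mulr0 (4 * M)); apply: cvgMr.
  by have /fine_cvgP[_] := dc.
apply/cvgrPdist_le => /= d d0; near=> n.
rewrite distrC (le_trans (Rintegral_bump_dist a (e0 n) HM lh))//.
apply: le_trans (ler_norm _) _.
by near: n; apply: cvgr0_norm_le.
Unshelve. all: by end_near. Qed.

Lemma bump_step_near a (x : R) : x != a ->
  bump_step a (harmonic n) x @[n --> \oo] --> ((a < x)%R%:R : R).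
Proof.
move=> xa; apply: cvg_near_cst.
have d0 : 0 < `|x - a| by rewrite normr_gt0 subr_eq0.
have : \forall n \near \oo, `|@harmonic R n| < `|x - a|.
  by apply: cvgr0_norm_lt => //; exact: cvg_harmonic.
apply: filterS => n; rewrite ger0_norm ?invr_ge0// => hn.
have h0 : 0 < harmonic n :> R by rewrite invr_gt0.
rewrite bump_stepE; apply/eqP; case: ltP => [ax|].
  by rewrite step_ge1// ler_pdivlMr// mul1r;
    rewrite gtr0_norm ?subr_gt0// in hn; exact: ltW.
move=> ax; rewrite step_leN1// ler_pdivrMr// mulN1r.
rewrite ler0_norm ?subr_le0// in hn; lra.
Qed.

Lemma bump_step_outside a b e (x : R) : 0 < e -> e <= 1 -> a < b ->
  (x < a - 1) || (b + 1 < x) -> (bump_step a e \- bump_step b e) x = 0.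
Proof.
move=> e0 e1 ab /=; rewrite !bump_stepE => /orP[xa|xb].
  by rewrite !step_leN1 ?subrr// ler_pdivrMr//; lra.
by rewrite !step_ge1 ?subrr// ler_pdivlMr//; lra.
Qed.

(** Dominated convergence: since [harmonic n] is at most 1, every integrand is bounded by |k| on
    [a - 1, b + 1] and vanishes outside. *)
Lemma cvg_Rintegral_bump_step k a b : locally_integrable setT k -> a < b ->
  \int[mu]_x (k x * (bump_step a (harmonic n) \- bump_step b (harmonic n)) x)
    @[n --> \oo] --> \int[mu]_(x in `[a, b]) k x.
Proof.
move=> lk ab.
have mk : measurable_fun setT k by case: lk.
have ms (c e : R) : measurable_fun setT (bump_step c e).
  apply: continuous_measurable_fun.
  exact/smooth_continuous/smooth_affine/smooth_step.
pose F n x := k x * (bump_step a (harmonic n) \- bump_step b (harmonic n)) x.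
have iab : mu.-integrable `[a, b] (EFin \o k).
  by apply: locally_integrable_compact => //; exact: segment_compact.
have iab' : mu.-integrable `]a, b] (EFin \o k).
  by apply: integrableS iab => //; exact: subset_itv_oc_cc.
have iG : mu.-integrable `[a - 1, b + 1] (EFin \o (fun x => `|k x|)).
  apply: integrable_norm.
  by apply: locally_integrable_compact => //; exact: segment_compact.
rewrite -Rintegral_itv_obnd_cbnd// Rintegral_mkcond.
have [|||||iF _ cF] := @dominated_convergence _ _ _ mu setT measurableT
  (fun n => EFin \o F n) (EFin \o (k \_ `]a, b]))
  (EFin \o ((fun x => `|k x|) \_ `[a - 1, b + 1])).
- move=> n; apply/measurable_EFinP; apply: measurable_funM => //.
  by apply: measurable_funB; exact: ms.
- by apply/measurable_EFinP; apply/(measurable_restrictT _ _).1 => //;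
  exact: measurable_funTS.
- have nab : mu.-negligible [set a; b].
    by apply: negligibleU; apply/negligibleP => //;
      exact: lebesgue_measure_set1.
  apply: negligibleS nab => x /= Hx;
    apply: contrapT => /not_orP[/eqP xa /eqP xb].
  apply: Hx => _; apply/cvg_EFin; first by near=> n.
  (* The difference of the two limiting Heaviside functions is the indicator of ]a, b]; only the
     points a and b, a null set, escape the pointwise limit. *)
  have -> : (k \_ `]a, b]) x = k x * ((a < x)%R%:R - (b < x)%R%:R).
    rewrite patchE; case: ifPn.
      by rewrite inE/= in_itv/= => /andP[-> xb']; rewrite ltNge xb' subr0 mulr1.
    rewrite notin_setE/= in_itv/= => /negP; rewrite negb_and -leNgt -ltNge.
    case/orP => H; last by rewrite H (lt_trans ab H) subrr mulr0.
    by rewrite !ltNge H (le_trans H (ltW ab)) subrr mulr0.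
  by apply: cvgMr; apply: cvgB; exact: bump_step_near.
- by rewrite -restrict_EFin; apply: (@integrable_mkcond _ _ _ mu _ _ _).1.
- apply: aeW => x n _ /=; rewrite lee_fin patchE; case: ifPn => [_|].
    rewrite normrM ler_piMr//= !bump_stepE.
    have /andP[s0 s1] := step_itv ((x - a) / harmonic n).
    have /andP[t0 t1] := step_itv ((x - b) / harmonic n).
    rewrite ler_norml; lra.
  rewrite notin_setE/= in_itv/= => /negP; rewrite negb_and -!ltNge.
  have h0 : 0 < harmonic n :> R by rewrite invr_gt0.
  have h1 : harmonic n <= 1 :> R by rewrite invf_le1// ler1n.
  move=> Hx; rewrite /F bump_step_outside ?mulr0 ?normr0//.
have iF' : (\int[mu]_x (EFin \o (k \_ `]a, b])) x)%E \is a fin_num.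
  exact: integrable_fin_num.
rewrite /Rintegral; apply: (@fine_cvg _ _ _ _ (fun n =>
  (\int[mu]_x (F n x)%:E)%E)).
by rewrite fineK.
Unshelve. all: by end_near. Qed.

(** The weak identity is tested on [bump_step a e \- bump_step b e]. Its derivative is a difference
    of approximate identities, which recover h a and h b at Lebesgue points, while the function
    itself tends to the indicator of the interval. *)
Lemma weak_derivative_FTC h k a b :
  locally_integrable setT h -> locally_integrable setT k ->
  weak_derivative h k -> lebesgue_pt h a -> lebesgue_pt h b -> a < b ->
  h b - h a = \int[mu]_(x in `[a, b]) k x.
Proof.
move=> lh lk wk ha hb ab.
have h0 n : 0 < harmonic n :> R by rewrite invr_gt0.
have := cvg_Rintegral_bump_step lk ab.
have -> : (fun n => \int[mu]_x
    (k x * (bump_step a (harmonic n) \- bump_step b (harmonic n)) x)) =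
  (fun n => \int[mu]_x (h x * bump b (harmonic n) x) -
            \int[mu]_x (h x * bump a (harmonic n) x)).
  apply/funext => n.
  have := wk _ (test_function_bump_step (h0 n) (ltW ab)).
  have -> : derive1 (bump_step a (harmonic n) \- bump_step b (harmonic n)) =
      bump a (harmonic n) \- bump b (harmonic n).
    apply: derive1_ext => x; apply: is_deriveB; exact: is_derive_bump_step.
  have ihb c : mu.-integrable setT (EFin \o (h \* bump c (harmonic n))).
    have mB := @measurable_ball R c (harmonic n *+ 2).
    have [M HM] := @derive1_step_bounded R.
    have : mu.-integrable (ball c (harmonic n *+ 2)) (EFin \o (h \* bump c
      (harmonic n))).
      apply: (@integrable_mul_bounded _ _ _ ((harmonic n)^-1 * M)) => //.
      - exact: locally_integrable_ball.
      - exact: measurable_bump.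
      - by move=> x; rewrite normrM gtr0_norm ?invr_gt0// ler_wpM2l//
        invr_ge0 ltW.
    move/(@integrable_mkcond _ _ _ mu _ (EFin \o (h \* bump c
      (harmonic n))) mB).1.
    rewrite restrict_EFin.
    congr (mu.-integrable _ (EFin \o _)); apply/funext => x.
    rewrite patchE; case: ifPn => //.
    rewrite notin_setE /ball/= => /negP; rewrite -leNgt => rx.
    rewrite bump_eq0 ?mulr0// distrC (lt_le_trans _ rx)//.
    by rewrite mulr2n ltrDl.
  under eq_Rintegral do rewrite /= mulrBr.
  rewrite RintegralB//; [|exact: ihb|exact: ihb].
  by move/eqP; rewrite -eqr_oppLR opprB => /eqP <-.
move=> H; apply: (cvg_unique _ _ H); first exact: Rhausdorff.
by apply: cvgB; apply: cvg_Rintegral_bump => //; exact: cvg_harmonic.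
Qed.

End WeakDerivative.

(** * Primitives of locally integrable functions *)

Section Primitive.
Context {R : realType}.
Notation mu := (@lebesgue_measure R).
Implicit Types (h k P : R -> R) (a b c x y : R).

Lemma nbhs_geW a x : a < x -> \forall y \near x, a <= y.
Proof. by move=> ax; apply: filterS (lt_nbhsr ax) => y /ltW. Qed.

Lemma nbhs_leW a x : x < a -> \forall y \near x, y <= a.
Proof. by move=> ax; apply: filterS (lt_nbhsl ax) => y /ltW. Qed.

Lemma locally_integrable_itv k a b : locally_integrable setT k ->
  mu.-integrable `[a, b] (EFin \o k).
Proof. by move=> lk; apply: locally_integrable_compact => //;
  exact: segment_compact. Qed.

Lemma Rintegral_itv_cat k a b c : locally_integrable setT k -> a <= b ->
  b <= c ->
  \int[mu]_(x in `[a, c]) k x =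
  \int[mu]_(x in `[a, b]) k x + \int[mu]_(x in `[b, c]) k x.
Proof.
move=> lk ab bc.
have iac := locally_integrable_itv a c lk.
have := Rintegral_itvB iac; move=> /(_ b); rewrite !bnd_simp => /(_ ab bc) H.
rewrite -(@Rintegral_itv_obnd_cbnd _ b) ?addrA; last first.
  apply: integrableS (locally_integrable_itv b c lk) => //.
  exact: subset_itv_oc_cc.
by rewrite -H addrC subrK.
Qed.

Lemma Rintegral_itv1 k a : \int[mu]_(x in `[a, a]) k x = 0.
Proof. by rewrite set_itv1 Rintegral_set1. Qed.

(** Stating this through increments over a <= b avoids both oriented integrals and the choice of an
    additive constant. *)
Definition is_primitive P k :=
  forall a b, a <= b -> P b - P a = \int[mu]_(x in `[a, b]) k x.

Lemma primitive_exists k : locally_integrable setT k ->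
  exists P, is_primitive P k.
Proof.
move=> lk.
(* This is the oriented integral from 0: for x != 0 one of the two intervals is empty, and for x = 0
   both integrals vanish. *)
exists (fun x => \int[mu]_(y in `[0, x]) k y - \int[mu]_(y in `[x, 0]) k y).
have itv0 a b : b < a -> \int[mu]_(y in `[a, b]) k y = 0.
  move=> ba; rewrite set_itv_ge ?Rintegral_set0// bnd_simp -ltNge//.
have side a : (0 <= a /\ \int[mu]_(y in `[a, 0]) k y = 0) \/
              (a <= 0 /\ \int[mu]_(y in `[0, a]) k y = 0).
  have [a0|] := lerP a 0; last by move=> a0; left; split;
    [exact: ltW|exact: itv0].
  have [->|an0] := eqVneq a 0; first by left; split => //;
    exact: Rintegral_itv1.
  by right; split => //; apply: itv0; rewrite lt_neqAle an0.
move=> a b ab; have [[a0 ->]|[a0 ->]] := side a;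
  have [[b0 ->]|[b0 ->]] := side b.
- by rewrite !subr0 (Rintegral_itv_cat lk a0 ab) addrAC subrr add0r.
- have a00 : a = 0 by apply/le_anti; rewrite a0 (le_trans ab b0).
  have b00 : b = 0 by apply/le_anti; rewrite b0 (le_trans a0 ab).
  by rewrite a00 b00 !Rintegral_itv1 !subr0.
- by rewrite subr0 sub0r opprK addrC -Rintegral_itv_cat.
- by rewrite (Rintegral_itv_cat lk ab b0) !sub0r opprK addrC addrK.
Qed.

Lemma continuous_primitive P k : locally_integrable setT k ->
  is_primitive P k -> continuous P.
Proof.
move=> lk Pk; suff H (x : R) : {for x, continuous P} by move=> x; exact: H.
have xx : x - 1 < x + 1 by lra.
have := parameterized_integral_continuous (ltW xx) (locally_integrable_itv
  (x - 1) (x + 1) lk).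
have x1 : x \in `]x - 1, x + 1[%R by rewrite in_itv/=; apply/andP; split; lra.
move=> /(within_continuous_continuous xx)/(_ x1) cx.
have : {for x, continuous (fun y =>
  P (x - 1) + parameterized_integral mu (x - 1) y k)}.
  by apply: cvgD => //; exact: cvg_cst.
rewrite /prop_for /continuous_at {2}/parameterized_integral -Pk; last lra.
rewrite subrKC; apply: cvg_trans; apply: near_eq_cvg; near=> y.
rewrite /parameterized_integral -Pk ?subrKC//.
near: y; by apply: nbhs_geW; lra.
Unshelve. all: by end_near. Qed.

Lemma is_derive_primitive P k x : locally_integrable setT k ->
  is_primitive P k -> lebesgue_pt k x -> is_derive x 1 P (k x).
Proof.
move=> lk Pk kx.
have [dF F'] : derivable (fun y => \int[mu]_(t in `[x - 1, y]) k t) x 1 /\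
    derive1 (fun y => \int[mu]_(t in `[x - 1, y]) k t) x = k x.
  have := @FTC1_lebesgue_pt R k (BLeft (x - 1)) x (x + 1); apply => //.
  - by lra.
  - exact: locally_integrable_itv.
  - by rewrite (@lte_fin R); lra.
apply: (@near_eq_is_derive _ _ _ (cst (P (x - 1)) + (fun y =>
  \int[mu]_(t in `[x - 1, y]) k t))).
  near=> y.
  have ya : x - 1 <= y by near: y; apply: nbhs_geW; lra.
  have -> : P y = P (x - 1) + (P y - P (x - 1)) by rewrite addrC subrK.
  by rewrite Pk.
rewrite -[k x]add0r; apply: is_deriveD.
by rewrite -F' derive1E; exact/derivableP.
Unshelve. all: by end_near. Qed.

(** Replacing [k] by [kap] under the integral changes nothing, and the fundamental theorem for a
    continuous integrand then holds at every point of the interval, not just almost everywhere. This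
    upgrades the a.e. relations between f, g and W to differential equations. *)
Lemma is_derive_primitive_ae P k (kap : R -> R) a b x :
  locally_integrable setT k ->
  is_primitive P k -> (forall y : R, a < y < b -> {for y, continuous kap}) ->
  {ae mu, forall y, a < y < b -> k y = kap y} -> a < x < b ->
  is_derive x 1 P (kap x).
Proof.
move=> lk Pk ckap kkap /andP[ax xb].
(* [kap] may be unbounded near a and b; on the compact [a', b'] around x it is integrable. *)
pose a' := (a + x) / 2; pose b' := (x + b) / 2.
have [aa' a'x xb' b'b] : [/\ a < a', a' < x, x < b' & b' < b].
  by rewrite /a' /b'; split; lra.
have sub : `[a', b'] `<=` `]a, b[.
  move=> y /=; rewrite !in_itv/=; lra.
have ckab : {within `[a', b'], continuous kap}.
  apply: (@continuous_subspaceW _ _ _ _ _ sub).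
  by rewrite continuous_open_subspace; [move=> y;
    rewrite inE/= in_itv => /ckap|exact: interval_open].
have ikap : mu.-integrable `[a', b'] (EFin \o kap).
  by apply: continuous_compact_integrable => //; exact: segment_compact.
have [dF F'] : derivable (fun y => \int[mu]_(t in `[a', y]) kap t) x 1 /\
    derive1 (fun y => \int[mu]_(t in `[a', y]) kap t) x = kap x.
  apply: (@continuous_FTC1 R kap (BLeft a') x b') => //.
  by apply: ckap; rewrite ax.
apply: (@near_eq_is_derive _ _ _ (cst (P a') + (fun y => \int[mu]_(t in `[a', y]) kap t))).
  near=> y.
  have ya : a' <= y by near: y; exact: nbhs_geW.
  have yb : y <= b' by near: y; exact: nbhs_leW.
  have -> : P y = P a' + (P y - P a') by rewrite addrC subrK.
  rewrite /= Pk//; congr (_ + fine _).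
  have sub' : `[a', y] `<=` `[a', b'] by apply: subset_itvl; rewrite bnd_simp.
  apply: ae_eq_integral => //.
  - by have /integrableP[] : mu.-integrable `[a', y] (EFin \o kap) by
    apply: integrableS ikap.
  - apply/measurable_EFinP; apply: measurable_funTS; by case: lk.
  - apply: filterS kkap; first exact: (ae_filter_ringOfSetsType mu).
    by move=> z H /sub'/sub /=; rewrite in_itv/= => zab; rewrite H.
rewrite -[kap x]add0r; apply: is_deriveD.
by rewrite -F' derive1E; exact/derivableP.
Unshelve. all: by end_near. Qed.

Lemma ae_dense (Q : R -> Prop) a b : {ae mu, forall x, Q x} -> a < b ->
  exists2 x, a < x < b & Q x.
Proof.
move=> [N [mN N0 QN]] ab; apply: contrapT => H.
have sub : `]a, b[ `<=` N.
  move=> x; rewrite /= in_itv/= => xab; apply: QN => /= Qx.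
  by apply: H; exists x.
have : mu `]a, b[ = 0%E.
  by apply: (@subset_measure0 _ _ _ mu _ N).
rewrite lebesgue_measure_itv/= lte_fin ab -EFinD => -[] /eqP.
by rewrite subr_eq0 gt_eqF.
Qed.

(** A single Lebesgue point [x0] fixes the additive constant; [weak_derivative_FTC] from [x0] then
    gives the equality at all other Lebesgue points. *)
Lemma weak_derivative_primitive h k : locally_integrable setT h ->
  locally_integrable setT k -> weak_derivative h k ->
  exists H, [/\ continuous H, is_primitive H k & {ae mu, forall x, h x = H x}].
Proof.
move=> lh lk hk.
have aeL : {ae mu, forall x, lebesgue_pt h x} by
  exact: lebesgue_differentiation.
have [P Pk] := primitive_exists lk.
have [x0 _ hx0] := ae_dense aeL (ltr01 : (0 : R) < 1).
exists (fun x => h x0 + (P x - P x0)).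
have Hk : is_primitive (fun x => h x0 + (P x - P x0)) k.
  by move=> a b ab; rewrite -Pk//; lra.
split => //; first exact: continuous_primitive Hk.
apply: filterS aeL; first exact: (ae_filter_ringOfSetsType mu).
move=> x hx.
have [xx0|xx0|->] := ltgtP x x0.
- have := weak_derivative_FTC lh lk hk hx hx0 xx0.
  by rewrite -Pk ?ltW//; lra.
- have := weak_derivative_FTC lh lk hk hx0 hx xx0.
  by rewrite -Pk ?ltW//; lra.
- by rewrite subrr addr0.
Qed.

(** No exceptional point survives: by monotonicity h x lies between the values of h at good points
    arbitrarily close on either side, where h agrees with the continuous H. *)
Lemma nondecreasing_ae_eq_continuous h H : {homo h : x y / x <= y} ->
  continuous H -> {ae mu, forall x, h x = H x} -> h = H.
Proof.
move=> hh cH hH; apply/funext => /= x; apply/eqP; rewrite eq_le; apply/andP;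
  split.
- apply/ler_addgt0Pr => /= e e0.
  have /cvgrPdist_le/(_ _ e0)[d /= d0 Hd] := cH x.
  have xd : x < x + d by rewrite ltrDl.
  have [y /andP[xy yd] hy] := ae_dense hH xd.
  have := Hd y; rewrite /ball_/= ltr_norml ler_norml => /(_ _)/andP.
  have := hh _ _ (ltW xy); rewrite hy => + Z.
  by have [|] := Z; lra.
- apply/ler_addgt0Pr => /= e e0.
  have /cvgrPdist_le/(_ _ e0)[d /= d0 Hd] := cH x.
  have xd : x - d < x by rewrite ltrBlDr ltrDl.
  have [y /andP[yd xy] hy] := ae_dense hH xd.
  have := Hd y; rewrite /ball_/= ltr_norml ler_norml => /(_ _)/andP.
  have := hh _ _ (ltW xy); rewrite hy => + Z.
  by have [|] := Z; lra.
Qed.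

End Primitive.

Section LocallyIntegrable.
Context {R : realType}.
Notation mu := (@lebesgue_measure R).
Implicit Types (c h g : R -> R).

Lemma locally_integrable_mul c h : continuous c -> locally_integrable setT h ->
  locally_integrable setT (fun x => c x * h x).
Proof.
move=> cc lh; have [mh _ _] := lh.
split; [|exact: openT|move=> K _ cK].
  by apply: measurable_funM => //; exact: continuous_measurable_fun.
have mK : measurable K by exact: compact_measurable.
suff /integrableP[_] : mu.-integrable K (EFin \o (fun x => c x * h x)) by [].
apply: (@integrableMr _ _ _ mu K mK c (EFin \o h)).
- by apply: measurable_funTS; exact: continuous_measurable_fun.
- have : bounded_set (c @` K).
    apply: compact_bounded; apply: continuous_compact => //.
    exact: continuous_subspaceT.
  by move=> [B [Br HB]]; exists B; split=> // y yB x Kx; apply: (HB _ yB);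
    exists x.
- exact: locally_integrable_compact.
Qed.

(** Comparison of |g| with 1 + g^2. *)
Lemma L2loc_locally_integrable g : L2loc g -> locally_integrable setT g.
Proof.
move=> [mg lg2]; split; [exact: mg|exact: openT|move=> K _ cK].
have mK : measurable K by exact: compact_measurable.
suff /integrableP[_] : mu.-integrable K (EFin \o g) by [].
have l1 : locally_integrable setT (fun x => 1 + g x ^+ 2).
  apply: (@locally_integrableD _ _ (cst 1)) => //.
  by apply: continuous_locally_integrable => ?; exact: cvg_cst.
apply: le_integrable (locally_integrable_compact l1 cK) => //.
  by apply/measurable_EFinP; exact: measurable_funTS.
move=> x _ /=; rewrite lee_fin (@ger0_norm _ (1 + _)) ?addr_ge0 ?sqr_ge0//.
rewrite -real_normK ?num_real//; set t := `|g x|.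
have := sqr_ge0 (t - 1); rewrite sqrrB1; have := sqr_ge0 t; lra.
Qed.

End LocallyIntegrable.

(** * Mean value inequalities and pointwise consequences of a derivative *)

Section MeanValue.
Context {R : realType}.
Implicit Types (F dF : R -> R) (a b x l K : R).

(** The slope function of Caratheodory is positive near x. Only the derivative at x itself is
    involved, which suffices to contradict monotonicity of f or a known sign of W. *)
Lemma is_derive_gt0 F x l : is_derive x 1 F l -> 0 < l ->
  (forall b, x < b -> exists2 y, x < y < b & F x < F y) /\
  (forall a, a < x -> exists2 y, a < y < x & F y < F x).
Proof.
move=> /is_derive1_caratheodory[G [FG cG Gx]] l0.
have [d /= d0 Hd] : \forall y \near x, 0 < G y.
  have N : nbhs (G x) [set y : R | 0 < y].
    by apply: open_nbhs_nbhs; split; [exact: open_gt|rewrite /= Gx].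
  exact: (cG _ N).
split=> [b xb|a ax].
- pose e := Num.min (b - x) d; have e0 : 0 < e by rewrite lt_min subr_gt0 xb.
  have [eb ed] : e <= b - x /\ e <= d by rewrite !ge_min !lexx orbT.
  exists (x + e / 2); first by lra.
  rewrite -subr_gt0 FG mulr_gt0//; last lra.
  by apply: Hd; rewrite /ball_/= opprD addNKr normrN gtr0_norm; lra.
- pose e := Num.min (x - a) d; have e0 : 0 < e by rewrite lt_min subr_gt0 ax.
  have [ea ed] : e <= x - a /\ e <= d by rewrite !ge_min !lexx orbT.
  exists (x - e / 2); first by lra.
  have G0 : 0 < G (x - e / 2).
    by apply: Hd; rewrite /ball_/= opprD opprK addNKr gtr0_norm; lra.
  have := FG (x - e / 2); have : 0 < G (x - e / 2) * (e / 2) by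
    rewrite mulr_gt0//; lra.
  have -> : x - e / 2 - x = - (e / 2) by lra.
  by rewrite mulrN; lra.
Qed.

Lemma is_derive_continuous F x l : is_derive x 1 F l -> {for x, continuous F}.
Proof.
by move=> [dF _]; apply/differentiable_continuous/derivable1_diffP.
Qed.

Lemma mean_value F dF a b : a < b ->
  (forall x, a <= x <= b -> {for x, continuous F}) ->
  (forall x, a < x < b -> is_derive x 1 F (dF x)) ->
  exists2 c, a < c < b & F b - F a = dF c * (b - a).
Proof.
move=> ab cF HF.
have HF' x : x \in `]a, b[%R -> is_derive x 1 F (dF x).
  by rewrite in_itv/=; exact: HF.
have cF' : {within `[a, b], continuous F}.
  by apply: continuous_in_subspaceT => x; rewrite inE/= in_itv/=; exact: cF.
have [c] := MVT ab HF' cF'.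
by rewrite in_itv/= => cab E; exists c.
Qed.

Lemma mean_value_le F dF a b K : a < b ->
  (forall x, a <= x <= b -> is_derive x 1 F (dF x)) ->
  (forall x, a <= x <= b -> dF x <= K) -> F b - F a <= K * (b - a).
Proof.
move=> ab HF HK.
have [x|x|c /andP[ac cb] ->] := @mean_value F dF a b ab.
- by move=> xab; apply: is_derive_continuous (HF _ xab).
- by move=> /andP[ax xb]; apply: HF; rewrite !ltW.
- by rewrite ler_wpM2r ?subr_ge0 ?(ltW ab)// HK// !ltW.
Qed.

Lemma mean_value_ge F dF a b K : a < b ->
  (forall x, a <= x <= b -> is_derive x 1 F (dF x)) ->
  (forall x, a <= x <= b -> K <= dF x) -> K * (b - a) <= F b - F a.
Proof.
move=> ab HF HK.
have [x|x|c /andP[ac cb] ->] := @mean_value F dF a b ab.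
- by move=> xab; apply: is_derive_continuous (HF _ xab).
- by move=> /andP[ax xb]; apply: HF; rewrite !ltW.
- by rewrite ler_wpM2r ?subr_ge0 ?(ltW ab)// HK// !ltW.
Qed.

Lemma continuous_itv_bounded F a b :
  (forall x, a <= x <= b -> {for x, continuous F}) ->
  exists2 B, 0 < B & forall x, a <= x <= b -> `|F x| <= B.
Proof.
move=> cF; have [ab|ba] := leP a b; last first.
  by exists 1 => // x /andP[ax xb]; have := le_trans ax xb; rewrite leNgt ba.
have [|c _ Hc] := @EVT_max _ (fun x => `|F x|) a b ab.
  apply: continuous_in_subspaceT => x; rewrite inE/= in_itv/= => xab.
  apply: (@continuous_comp _ _ _ F (fun y => `|y|)); first exact: cF.
  exact: norm_continuous.
exists (`|F c| + 1); first by rewrite ltr_wpDl.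
by move=> x xab; rewrite (le_trans (Hc _ _)) ?in_itv//= lerDl.
Qed.

End MeanValue.

(** * Profiles *)

Section WeakProfile.
Context {R : realType} (p s q M : R) (S sg : R -> R).
Notation mu := (@lebesgue_measure R).

(** Here p, q, s stand for the densities R-, R+ and Rs, M for m^2 and sg for S'. [profile_deriv] is
    the definition of the flux solved for f', and [flux_deriv] is the profile equation with f'
    eliminated. Both are restricted to f != s, where sg does not vanish; [profile_sonic] makes up
    for this at the excluded level. *)
Record classical_profile (alpha : R) (f W : R -> R) : Prop := {
  profile_range : forall x, p <= f x <= q ;
  profile_homo : {homo f : x y / x <= y} ;
  profile_continuous : continuous f ;
  profile_onto : forall r, p < r < q -> exists x, f x = r ;
  profile_deriv : forall x, f x != s ->
    is_derive x 1 f (W x * f x / (alpha * sg (f x))) ;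
  flux_deriv : forall x, f x != s ->
    is_derive x 1 W (S (f x) / f x -
                     2 * M * W x ^+ 2 / (alpha * f x ^+ 2 * sg (f x) ^+ 2)) ;
  profile_sonic : forall a b, f a = s -> f b = s -> a = b }.

Context (p_gt0 : 0 < p).
Context (s_itv : p < s < q).
Context (M_gt0 : 0 < M).
Context (S_deriv : forall r : R, 0 < r -> is_derive r 1 S (sg r)).
Context (sg_continuous : forall r : R, 0 < r -> {for r, continuous sg}).
Context (sg_gt0 : forall r, 0 < r < s -> 0 < sg r).
Context (sg_lt0 : forall r, s < r -> sg r < 0).
Context (sg_s : sg s = 0).
Context (S_gt0 : forall r, p < r < q -> 0 < S r).

Lemma sg_neq0 (r : R) : 0 < r -> r != s -> sg r != 0.
Proof.
move=> r0; rewrite neq_lt => /orP[rs|sr].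
  by rewrite gt_eqF// sg_gt0// r0.
by rewrite lt_eqF// sg_lt0.
Qed.

Lemma S_continuous (r : R) : 0 < r -> {for r, continuous S}.
Proof.
move=> r0; apply/differentiable_continuous/derivable1_diffP.
by have [] := S_deriv r0.
Qed.

(** * From the weak profile equation to the first order system *)

Section OneProfile.
Context (alpha : R) (f g : R -> R).
Context (alpha_gt0 : 0 < alpha).
Context (f_range : forall x, p <= f x <= q).
Context (f_homo : {homo f : x y / x <= y}).
Context (f_left : f x @[x --> -oo] --> p).
Context (f_right : f x @[x --> +oo] --> q).
Context (fg : W12loc_with f g).

(** The profile equation says that [weak_flux] has this weak derivative. Both contain the weak
    gradient [g], known only almost everywhere, until [density_of_flux] expresses it through f and
    W. *)
Definition flux_density x :=
  S (f x) / f x - 2 * alpha * (M / f x ^+ 4) * g x ^+ 2.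

Definition weak_flux x := alpha * (sg (f x) / f x) * g x.

Context (weak_eq : weak_derivative weak_flux flux_density).

Lemma f_gt0 x : 0 < f x.
Proof. by have /andP[+ _] := f_range x; exact: lt_le_trans. Qed.

Lemma f_primitive : continuous f /\ is_primitive f g.
Proof.
have [lf lg wfg] := fg.
have [H [cH Hg fH]] := weak_derivative_primitive
  (L2loc_locally_integrable lf) (L2loc_locally_integrable lg) wfg.
by rewrite (nondecreasing_ae_eq_continuous f_homo cH fH).
Qed.

Let cf : continuous f. Proof. by have [] := f_primitive. Qed.

Lemma continuous_comp_pos (F : R -> R) :
  (forall r, 0 < r -> {for r, continuous F}) -> continuous (fun x => F (f x)).
Proof.
move=> cF x; apply: (@continuous_comp _ _ _ f F); first exact: cf.
exact/cF/f_gt0.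
Qed.

Lemma locally_integrable_weak_flux : locally_integrable setT weak_flux.
Proof.
have [_ lg _] := fg.
apply: (@locally_integrable_mul _ (fun x => alpha * (sg (f x) / f x)));
  last first.
  exact: L2loc_locally_integrable.
move=> x; apply: cvgM; first exact: cvg_cst.
apply: cvgM; first exact: (continuous_comp_pos sg_continuous).
by apply: cvgV; [rewrite gt_eqF// f_gt0|exact: cf].
Qed.

Lemma locally_integrable_flux_density : locally_integrable setT flux_density.
Proof.
have [_ [_ lg2] _] := fg.
apply: (@locally_integrableB _ _ (fun x => S (f x) / f x)).
  apply: continuous_locally_integrable => x.
  apply: cvgM; first exact: (continuous_comp_pos S_continuous).
  by apply: cvgV; [rewrite gt_eqF// f_gt0|exact: cf].
apply: (@locally_integrable_mul _ (fun x => 2 * alpha * (M / f x ^+ 4))) => //.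
move=> x; apply: cvgM; first exact: cvg_cst.
apply: cvgM; first exact: cvg_cst.
apply: cvgV; first by rewrite gt_eqF// exprn_gt0// f_gt0.
by apply: (@continuous_comp _ _ _ f (fun y => y ^+ 4));
  [exact: cf|exact: exprn_continuous].
Qed.

Lemma f_onto r : p < r < q -> exists x, f x = r.
Proof.
move=> /andP[pr rq].
have [a fa] : exists a, f a <= r.
  have : \forall x \near -oo, f x <= r by apply: cvgr_le pr.
  move=> [A [_ HA]]; exists (A - 1); apply: HA.
  by rewrite ltrBlDr ltrDl.
have [b fb] : exists b, r <= f b.
  have : \forall x \near +oo, r <= f x by apply: cvgr_ge rq.
  move=> [A [_ HA]]; exists (A + 1); apply: HA.
  by rewrite ltrDl.
have [ab|/ltW ba] := leP a b.
  have [||x _ <-] := @IVT _ f a b r ab; last by exists x.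
  - exact: continuous_subspaceT.
  - by rewrite min_l ?max_r ?fa ?fb// f_homo.
by exists a; apply/le_anti; rewrite fa (le_trans fb)// f_homo.
Qed.

Lemma near_not_sonic x : f x != s ->
  exists a b, a < x < b /\ forall y, a < y < b -> f y != s.
Proof.
move=> fxs.
have [d /= d0 Hd] : \forall y \near x, f y != s.
  have N : nbhs (f x) [set y : R | y != s].
    by apply: open_nbhs_nbhs; split=> //; exact: open_neq.
  exact: (cf N).
exists (x - d), (x + d); split; first by rewrite ltrBlDr !ltrDl d0.
by move=> y yd; apply: Hd; rewrite /ball_/= ltr_distlC.
Qed.

Section Flux.
Context (W : R -> R).
Context (cW : continuous W) (W_primitive : is_primitive W flux_density).
Context (W_flux : {ae mu, forall x, weak_flux x = W x}).

Lemma density_of_flux x : f x != s -> weak_flux x = W x ->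
  g x = W x * f x / (alpha * sg (f x)).
Proof.
move=> fxs <-; have f0 := f_gt0 x; have sg0 := sg_neq0 f0 fxs.
by rewrite /weak_flux; field; rewrite sg0 !gt_eqF.
Qed.

Lemma is_derive_profile x : f x != s ->
  is_derive x 1 f (W x * f x / (alpha * sg (f x))).
Proof.
move=> fxs; have [_ lg _] := fg; have [_ fpr] := f_primitive.
have [a [b [xab Hab]]] := near_not_sonic fxs.
apply: (@is_derive_primitive_ae _ f g (fun x =>
  W x * f x / (alpha * sg (f x))) a b) => //.
- exact: L2loc_locally_integrable.
- move=> y /Hab fys; apply: cvgM; first by apply: cvgM; [exact: cW|exact: cf].
  apply: cvgV.
    by apply: mulf_neq0; [rewrite gt_eqF|rewrite sg_neq0// f_gt0].
  apply: cvgM; first exact: cvg_cst.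
  exact: (continuous_comp_pos sg_continuous).
- apply: filterS W_flux; first exact: (ae_filter_ringOfSetsType mu).
  by move=> y Wy /Hab fys; exact: density_of_flux.
Qed.

Lemma is_derive_flux x : f x != s ->
  is_derive x 1 W (S (f x) / f x -
                   2 * M * W x ^+ 2 / (alpha * f x ^+ 2 * sg (f x) ^+ 2)).
Proof.
move=> fxs.
have [a [b [xab Hab]]] := near_not_sonic fxs.
have csq (h : R -> R) y : {for y, continuous h} ->
  {for y, continuous (fun z => h z ^+ 2)}.
  by move=> ch; apply: (@continuous_comp _ _ _ h (fun z => z ^+ 2));
    [exact: ch|exact: exprn_continuous].
apply: (@is_derive_primitive_ae _ W flux_density (fun x =>
  S (f x) / f x - 2 * M * W x ^+ 2 / (alpha * f x ^+ 2 * sg (f x) ^+ 2)) a b) => //.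
- exact: locally_integrable_flux_density.
- move=> y /Hab fys; have f0 := f_gt0 y; have sg0 := sg_neq0 f0 fys.
  apply: cvgB.
    apply: cvgM; first exact: (continuous_comp_pos S_continuous).
    by apply: cvgV; [rewrite gt_eqF|exact: cf].
  apply: cvgM; first by apply: cvgM; [exact: cvg_cst|exact/csq/cW].
  apply: cvgV.
    by apply/mulf_neq0/expf_neq0 => //; rewrite mulf_neq0 ?expf_neq0 ?gt_eqF.
  apply: cvgM; first by apply: cvgM; [exact: cvg_cst|exact/csq/cf].
  by apply/csq/(continuous_comp_pos sg_continuous).
- apply: filterS W_flux; first exact: (ae_filter_ringOfSetsType mu).
  move=> y Wy /Hab fys; rewrite /flux_density (density_of_flux fys Wy).
  have f0 := f_gt0 y; have sg0 := sg_neq0 f0 fys.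
  by field; rewrite sg0 !gt_eqF.
Qed.

(** On a plateau at height s the gradient g vanishes, so W' = S(s)/s > 0; yet W = 0 there because
    the flux carries the factor sg s = 0. *)
Lemma sonic_point a b : f a = s -> f b = s -> ~ a < b.
Proof.
move=> fa fb ab; have [_ lg _] := fg; have [_ fpr] := f_primitive.
have fs y : a <= y <= b -> f y = s.
  by move=> /andP[ay yb]; apply/le_anti; rewrite -{1}fb -fa !f_homo.
have [ps sq] := andP s_itv; have s0 : 0 < s by exact: lt_trans ps.
have g0 : {ae mu, forall y, a < y < b -> g y = 0}.
  have := @lebesgue_differentiation _ _ (L2loc_locally_integrable lg).
  apply: filterS; first exact: (ae_filter_ringOfSetsType mu).
  move=> y gy /andP[ay yb].
  have [_ <-] := is_derive_primitive (L2loc_locally_integrable lg) fpr gy.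
  rewrite (@near_eq_derive _ _ _ _ (cst s)); first exact: derive_cst.
  near=> z; rewrite fs//; apply/andP; split; near: z.
    exact: nbhs_geW.
  exact: nbhs_leW.
have W0 : {ae mu, forall y, a < y < b -> W y = 0}.
  apply: filterS W_flux; first exact: (ae_filter_ringOfSetsType mu).
  by move=> y <- /andP[ay yb]; rewrite /weak_flux fs ?ltW//
    sg_s mul0r mulr0 mul0r.
have dW y : a < y < b -> is_derive y 1 W (S s / s).
  apply: (@is_derive_primitive_ae _ W flux_density (cst (S s / s)) a b y) => //.
  - exact: locally_integrable_flux_density.
  - by move=> z _; exact: cvg_cst.
  - apply: filterS g0; first exact: (ae_filter_ringOfSetsType mu).
    move=> z gz zab; rewrite /flux_density gz// expr2 !mulr0 subr0 fs//.
    by case/andP: zab => *; rewrite !ltW.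
(* W vanishes only almost everywhere a priori; picking one zero in each half of the interval gives
   two ordered zeros for the mean value theorem. *)
have [y1 /andP[ay1 y1m] Wy1] : exists2 y, a < y < (a + b) / 2 & a < y < b ->
  W y = 0.
  by apply: ae_dense W0 _; lra.
have [y2 /andP[my2 y2b] Wy2] : exists2 y, (a + b) / 2 < y < b & a < y < b ->
  W y = 0.
  by apply: ae_dense W0 _; lra.
have y12 : y1 < y2 by lra.
have [||c _] := @MVT _ W (cst (S s / s)) y1 y2 y12.
- by move=> y; rewrite in_itv/= => yy; apply: dW; lra.
- exact: continuous_subspaceT.
rewrite Wy1 ?Wy2; [|lra|lra].
rewrite subrr /= => E; have : 0 < S s / s * (y2 - y1).
  by rewrite mulr_gt0 ?subr_gt0// divr_gt0// S_gt0// ps.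
by rewrite -E ltxx.
Unshelve. all: by end_near. Qed.

End Flux.

Lemma classical_profile_exists : exists W, classical_profile alpha f W.
Proof.
have [W [cW Wpr Wae]] := weak_derivative_primitive locally_integrable_weak_flux
  locally_integrable_flux_density weak_eq.
exists W; split => //.
- exact: f_onto.
- exact: is_derive_profile.
- exact: is_derive_flux.
- move=> a b fa fb; have [ab|ba|//] := ltgtP a b.
    by case: (sonic_point cW Wpr Wae fa fb).
  by case: (sonic_point cW Wpr Wae fb fa).
Qed.

End OneProfile.

(** * Signs, strict monotonicity and decay of the flux of one profile *)

Section ClassicalProfile.
Context (alpha : R) (f W : R -> R).
Context (alpha_gt0 : 0 < alpha) (fW : classical_profile alpha f W).

Let f_homo : {homo f : x y / x <= y}. Proof. exact: profile_homo fW. Qed.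

Lemma profile_gt0 x : 0 < f x.
Proof. by have /andP[+ _] := profile_range fW x; exact: lt_le_trans. Qed.

Lemma profile_deriv_ge0 x : f x != s -> 0 <= W x * f x / (alpha * sg (f x)).
Proof.
move=> fxs; rewrite leNgt; apply/negP => l0.
have dNf := is_deriveN (profile_deriv fW fxs).
have [|H _] := is_derive_gt0 dNf; first by rewrite oppr_gt0.
have [|y /andP[xy _]] := H (x + 1); first by rewrite ltrDl.
by rewrite /= ltrN2 ltNge f_homo// ltW.
Qed.

Lemma flux_ge0 x : f x < s -> 0 <= W x.
Proof.
move=> fxs; have f0 := profile_gt0 x.
have sg0 : 0 < sg (f x) by rewrite sg_gt0// f0.
have := profile_deriv_ge0 (negbT (lt_eqF fxs)).
by rewrite -mulrA pmulr_lge0// divr_gt0// mulr_gt0.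
Qed.

Lemma flux_le0 x : s < f x -> W x <= 0.
Proof.
move=> sfx; have f0 := profile_gt0 x; have sg0 := sg_lt0 sfx.
have := profile_deriv_ge0 (negbT (gt_eqF sfx)).
by rewrite -mulrA nmulr_lge0// pmulr_rlt0// invr_lt0 pmulr_rlt0.
Qed.

(** At a zero of W the equation leaves W' = S/f > 0. Then W is negative just before x or positive
    just after it, against [flux_ge0] when f x < s and against [flux_le0] when f x > s. *)
Lemma flux_neq0 x : p < f x < q -> f x != s -> W x != 0.
Proof.
move=> fpq fxs; apply/eqP => Wx; have f0 := profile_gt0 x.
have := flux_deriv fW fxs; rewrite Wx expr0n mulr0 mul0r subr0 => dW.
have [|HR HL] := is_derive_gt0 dW; first by rewrite divr_gt0 ?S_gt0.
move: fxs; rewrite neq_lt => /orP[fs|sf].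
- have [|y /andP[_ yx]] := HL (x - 1); first by rewrite ltrBlDr ltrDl.
  by rewrite Wx ltNge flux_ge0// (le_lt_trans _ fs)// f_homo// ltW.
- have [|y /andP[xy _]] := HR (x + 1); first by rewrite ltrDl.
  by rewrite Wx ltNge flux_le0// (lt_le_trans sf)// f_homo// ltW.
Qed.

Lemma profile_deriv_gt0 x : p < f x < q -> f x != s ->
  0 < W x * f x / (alpha * sg (f x)).
Proof.
move=> fpq fxs; rewrite lt_neqAle profile_deriv_ge0// andbT eq_sym.
rewrite mulf_neq0 ?mulf_neq0 ?flux_neq0 ?invr_eq0 ?mulf_neq0//.
- by rewrite gt_eqF// profile_gt0.
- by rewrite gt_eqF.
- by rewrite sg_neq0// profile_gt0.
Qed.

(** A plateau at height s is excluded by [profile_sonic], and at any other height by the strictly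
    positive derivative. *)
Lemma profile_lt x y : p < f x < q -> x < y -> f x < f y.
Proof.
move=> fpq xy; rewrite lt_neqAle f_homo ?(ltW xy)// andbT; apply/eqP => fxy.
have [fxs|fxs] := eqVneq (f x) s.
  have : x = y by apply: (profile_sonic fW) => //; rewrite -fxy.
  by move=> E; rewrite E ltxx in xy.
have [HR _] := is_derive_gt0 (profile_deriv fW fxs) (profile_deriv_gt0 fpq fxs).
have [z /andP[xz zy]] := HR y xy.
by rewrite fxy ltNge f_homo// ltW.
Qed.

Lemma profile_inj x y : p < f x < q -> f x = f y -> x = y.
Proof.
move=> fpq fxy; have [xy|yx|//] := ltgtP x y.
  by have := profile_lt fpq xy; rewrite fxy ltxx.
by have := fpq; rewrite {1 2}fxy => fpq'; have := profile_lt fpq' yx;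
  rewrite fxy ltxx.
Qed.

(* If the flux at x0 exceeded eta, the one-sided bound on its derivative would
   keep it above eta / 2 on an interval of fixed length before x0 (after x0 on
   the subsonic side), along which f grows by more than the remaining room. *)
Lemma flux_small (eta : R) : 0 < eta -> exists2 rho, 0 < rho &
  forall x, (f x < p + rho) || (q - rho < f x) -> `|W x| <= eta.
Proof.
move=> eta0; have /andP[ps sq] := s_itv.
have [K K0 HK] : exists2 K, 0 < K & forall x, p <= x <= q -> `|S x / x| <= K.
  apply: continuous_itv_bounded => x /andP[px _].
  have x0 : 0 < x by exact: lt_le_trans px.
  apply: cvgM; first exact: S_continuous.
  by apply: cvgV; [rewrite gt_eqF|exact: cvg_id].
have [B B0 HB] : exists2 B, 0 < B & forall x, p <= x <= q -> `|sg x| <= B.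
  apply: continuous_itv_bounded => x /andP[px _].
  by apply: sg_continuous; exact: lt_le_trans px.
(* Over a length [h] a slope of at most K raises W by at most eta/2. [c] is a lower bound for
   f/(alpha |sg f|), so [grow] is the least rise of f over that length while |W| >= eta/2. *)
pose h := eta / (2 * K); have h0 : 0 < h by rewrite divr_gt0// mulr_gt0.
pose c := p / (alpha * B); have c0 : 0 < c by rewrite divr_gt0// mulr_gt0.
pose grow := eta / 2 * c * h.
have grow0 : 0 < grow by rewrite mulr_gt0// mulr_gt0// divr_gt0.
(* The terms s - p and q - s keep x0 strictly on one side of the sonic level. *)
pose rho := Num.min grow (Num.min (s - p) (q - s)).
have rho0 : 0 < rho by rewrite !lt_min grow0 !subr_gt0 ps.
have [rg rp rq] : [/\ rho <= grow, rho <= s - p & rho <= q - s].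
  by rewrite /rho; split; rewrite !ge_min lexx ?orbT.
exists rho => // x0.
(* W' is bounded uniformly only from above, because the discarded term has sg^2 in its denominator.
   This is why the argument runs backwards in x before s and forwards after it. *)
have flux_le y : S (f y) / f y - 2 * M * W y ^+ 2 / (alpha * f y ^+ 2 * sg
  (f y) ^+ 2) <= K.
  have := HK _ (profile_range fW y); rewrite ler_norml => /andP[_ HK'].
  have : 0 <= 2 * M * W y ^+ 2 / (alpha * f y ^+ 2 * sg (f y) ^+ 2).
    by apply: divr_ge0; apply: mulr_ge0;
      rewrite ?sqr_ge0// mulr_ge0 ?sqr_ge0// ltW.
  by lra.
have Kh : K * h = eta / 2 by rewrite /h; field; rewrite gt_eqF.
have slope y : eta / 2 <= `|W y| -> f y != s ->
    eta / 2 * c <= W y * f y / (alpha * sg (f y)).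
  move=> Wy fys; rewrite -[leRHS]ger0_norm ?profile_deriv_ge0//.
  have fy0 := profile_gt0 y; have /andP[pf _] := profile_range fW y.
  have sgy : 0 < `|sg (f y)| by rewrite normr_gt0 sg_neq0.
  rewrite normrM normfV !normrM (gtr0_norm fy0)
    (gtr0_norm alpha_gt0) -[leRHS]mulrA.
  apply: ler_pM => //; [by rewrite divr_ge0// ltW|exact: ltW|].
  apply: ler_pM => //; [exact: ltW|by rewrite invr_ge0 mulr_ge0// ltW|].
  rewrite lef_pV2 ?posrE ?mulr_gt0//.
  by rewrite ler_wpM2l ?(ltW alpha_gt0)// HB// (profile_range fW).
case/orP => [fx|fx]; rewrite leNgt; apply/negP => Wx.
- have fs y : y <= x0 -> f y < s.
    by move=> yx; have := f_homo yx; lra.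
  rewrite ger0_norm ?flux_ge0 ?fs// in Wx.
  have Wlow y : x0 - h <= y <= x0 -> eta / 2 <= W y.
    move=> /andP[hy]; rewrite le_eqVlt => /predU1P[->|yx]; first lra.
    have := @mean_value_le _ W _ y x0 K yx
      (fun z zy => flux_deriv fW (negbT (lt_eqF (fs z (proj2 (andP zy))))))
      (fun z _ => flux_le z).
    have : K * (x0 - y) <= K * h by rewrite ler_wpM2l ?(ltW K0)//; lra.
    by lra.
  have hx : x0 - h < x0 by lra.
  have := @mean_value_ge _ f _ (x0 - h) x0 (eta / 2 * c) hx
    (fun z zy => profile_deriv fW (negbT (lt_eqF (fs z (proj2 (andP zy)))))).
  have /andP[pfh _] := profile_range fW (x0 - h).
  have -> : x0 - (x0 - h) = h by lra.
  rewrite -/grow => H; suff : grow <= f x0 - f (x0 - h) by lra.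
  apply: H => z zx; apply: slope.
    by rewrite (le_trans (Wlow _ zx))// ler_norm.
  by rewrite lt_eqF// fs//; case/andP: zx.
- have sf y : x0 <= y -> s < f y.
    by move=> xy; have := f_homo xy; lra.
  rewrite ler0_norm ?flux_le0 ?sf// in Wx.
  have Wup y : x0 <= y <= x0 + h -> W y <= - (eta / 2).
    move=> /andP[]; rewrite le_eqVlt => /predU1P[<-|xy] hy; first lra.
    have := @mean_value_le _ W _ x0 y K xy
      (fun z zy => flux_deriv fW (negbT (gt_eqF (sf z (proj1 (andP zy))))))
      (fun z _ => flux_le z).
    have : K * (y - x0) <= K * h by rewrite ler_wpM2l ?(ltW K0)//; lra.
    by lra.
  have hx : x0 < x0 + h by lra.
  have := @mean_value_ge _ f _ x0 (x0 + h) (eta / 2 * c) hx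
    (fun z zy => profile_deriv fW (negbT (gt_eqF (sf z (proj1 (andP zy)))))).
  have /andP[_ fhq] := profile_range fW (x0 + h).
  have -> : x0 + h - x0 = h by lra.
  rewrite -/grow => H; suff : grow <= f (x0 + h) - f x0 by lra.
  apply: H => z zx; apply: slope.
    by rewrite ler_normr; apply/orP; right; have := Wup _ zx; lra.
  by rewrite gt_eqF// sf//; case/andP: zx.
Qed.

(** * The inverse of a profile, and the energy as a function of density *)

Section Inverse.
Context (X : R -> R) (fX : forall r, p < r < q -> f (X r) = r).

Lemma inverse_lt r1 r2 : p < r1 < q -> p < r2 < q -> r1 < r2 -> X r1 < X r2.
Proof.
move=> h1 h2 r12; rewrite ltNge; apply/negP => /f_homo.
by rewrite !fX// leNgt r12.
Qed.

Lemma near_profile_itv x : p < f x < q -> \forall y \near x, p < f y < q.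
Proof.
move=> fpq.
have N : nbhs (f x) [set r : R | p < r < q].
  apply: open_nbhs_nbhs; split => //.
  have -> : [set r : R | p < r < q] = `]p, q[%classic.
    by apply/seteqP; split=> r /=; rewrite in_itv.
  exact: interval_open.
exact: (profile_continuous fW N).
Qed.

(** Strict monotonicity puts r strictly between f (X r - e) and f (X r + e), and monotonicity
    transfers this to nearby densities. The case r = s is included; it is what joins the two sides
    in [scaled_inverse_unique]. *)
Lemma inverse_continuous r : p < r < q -> {for r, continuous X}.
Proof.
move=> rpq; have /andP[pr rq] := rpq; apply/cvgrPdist_le => /= e e0.
have fl : f (X r - e) < r.
  have [pf|fp] := ltP p (f (X r - e)); last exact: le_lt_trans pr.
  have [fr|rf] := ltP (f (X r - e)) r; first by [].
  have H : f (X r - e) <= r by rewrite -[leRHS]fX// f_homo// lerBlDr lerDl ltW.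
  have E : f (X r - e) = f (X r) by rewrite fX//; apply/le_anti; rewrite H.
  have : X r - e = X r by apply: profile_inj => //; rewrite E fX.
  by lra.
have fr : r < f (X r + e).
  by rewrite -[ltLHS]fX// profile_lt ?fX// ltrDl.
near=> t.
have tpq : p < t < q.
  apply/andP; split; near: t; [exact: lt_nbhsr|exact: lt_nbhsl].
have t1 : f (X r - e) < t by near: t; exact: lt_nbhsr.
have t2 : t < f (X r + e) by near: t; exact: lt_nbhsl.
have X1 : X r - e < X t.
  by rewrite ltNge; apply/negP => /f_homo; rewrite fX// leNgt t1.
have X2 : X t < X r + e.
  by rewrite ltNge; apply/negP => /f_homo; rewrite fX// leNgt t2.
by rewrite ler_norml; apply/andP; split; lra.
Unshelve. all: by end_near. Qed.

Lemma is_derive_inverse_profile r : p < r < q -> r != s ->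
  is_derive r 1 X (alpha * sg r / (W (X r) * r)).
Proof.
move=> rpq rs.
have fXs : f (X r) != s by rewrite fX.
have fXpq : p < f (X r) < q by rewrite fX.
have := @is_derive_inverse R f X _ (X r) _ _ (profile_deriv fW fXs).
rewrite fX// invf_div; apply.
- near=> y; apply: (@profile_inj _ y); last first.
    by rewrite fX//; near: y; exact: near_profile_itv.
  by rewrite fX; near: y; exact: near_profile_itv.
- by near=> y; exact: (profile_continuous fW).
- by have := profile_deriv_gt0 fXpq fXs; rewrite fX// => /gt_eqF ->.
Unshelve. all: by end_near. Qed.

Lemma inverse_flux_neq0 r : p < r < q -> r != s -> W (X r) != 0.
Proof. by move=> rpq rs; apply: flux_neq0; rewrite fX. Qed.

Definition flux_energy r := alpha^-1 * (W (X r) * W (X r)).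

(** In dV/dr = (2 W/alpha) W' X' the factor alpha/W of X' cancels 2 W/alpha. The source term becomes
    free of W, and the term quadratic in W becomes linear in V. *)
Lemma is_derive_flux_energy r : p < r < q -> r != s ->
  is_derive r 1 flux_energy
    (2 * S r * sg r / r ^+ 2 - 4 * M / (r ^+ 3 * sg r) * flux_energy r).
Proof.
move=> rpq rs.
have r0 : 0 < r by have /andP[+ _] := rpq; exact: lt_trans.
have fXs : f (X r) != s by rewrite fX.
have dX := is_derive_inverse_profile rpq rs.
have dW := flux_deriv fW fXs; rewrite fX// in dW.
have dWX := @is_derive1_comp _ W X r _ _ dW dX.
have dWW := is_deriveM dWX dWX.
have dV := @is_deriveZ _ _ _ _ alpha^-1 _ _ _ dWW.
apply: (is_derive_eq dV); rewrite /flux_energy /= /GRing.scale /=.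
have W0 := inverse_flux_neq0 rpq rs; have sg0 := sg_neq0 r0 rs.
by field; rewrite W0 sg0 !gt_eqF.
Qed.

Lemma flux_energy_small (e : R) : 0 < e -> exists2 rho, 0 < rho &
  forall r, p < r < q -> (r < p + rho) || (q - rho < r) ->
  0 <= flux_energy r <= e.
Proof.
(* With eta <= 1 one has eta^2 <= eta <= alpha e, so |W| <= eta gives W^2/alpha <= e without a
   square root. *)
move=> e0; pose eta := Num.min 1 (alpha * e).
have eta0 : 0 < eta by rewrite lt_min ltr01 mulr_gt0.
have [eta1 etae] : eta <= 1 /\ eta <= alpha * e by rewrite !ge_min !lexx orbT.
have [rho rho0 H] := flux_small eta0; exists rho => // r rpq Hr.
rewrite /flux_energy -expr2 mulr_ge0 ?sqr_ge0 ?invr_ge0 ?(ltW alpha_gt0)//=.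
rewrite ler_pdivrMl// -real_normK ?num_real//.
have Wr : `|W (X r)| <= eta by apply: H; rewrite fX.
apply: le_trans etae; rewrite expr2 -[leRHS]mulr1.
by apply: ler_pM => //; exact: le_trans eta1.
Qed.

End Inverse.
End ClassicalProfile.

(** * Comparison of two profiles, possibly with different alpha *)

Section TwoProfiles.
Context (a1 a2 : R) (f1 f2 W1 W2 X1 X2 : R -> R).
Context (a1_gt0 : 0 < a1) (a2_gt0 : 0 < a2).
Context (fW1 : classical_profile a1 f1 W1) (fW2 : classical_profile a2 f2 W2).
Context (fX1 : forall r, p < r < q -> f1 (X1 r) = r).
Context (fX2 : forall r, p < r < q -> f2 (X2 r) = r).

Let V1 := flux_energy a1 W1 X1.
Let V2 := flux_energy a2 W2 X2.

(* The energies solve the same linear equation, so the square of their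
   difference is monotone away from the end states, where it vanishes. *)
Lemma flux_energy_unique r : p < r < q -> r != s -> V1 r = V2 r.
Proof.
move=> rpq rs; have /andP[ps sq] := s_itv.
pose D := V1 \- V2; pose dD t := - (4 * M / (t ^+ 3 * sg t) * D t).
have HD t : p < t < q -> t != s -> is_derive t 1 D (dD t).
  move=> tpq ts.
  have d1 := is_derive_flux_energy a1_gt0 fW1 fX1 tpq ts.
  have d2 := is_derive_flux_energy a2_gt0 fW2 fX2 tpq ts.
  by apply: (is_derive_eq (is_deriveB d1 d2)); rewrite /dD /D /V1 /V2 /=; ring.
pose E := D * D; pose dE t := - (8 * M / (t ^+ 3 * sg t) * (D t * D t)).
have HE t : p < t < q -> t != s -> is_derive t 1 E (dE t).
  move=> tpq ts; have d := HD _ tpq ts.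
  by apply: (is_derive_eq (is_deriveM d d)); rewrite /dE /dD /GRing.scale /=;
    ring.
have Dle (e : R) : 0 < e -> exists2 rho, 0 < rho & forall t, p < t < q ->
    (t < p + rho) || (q - rho < t) -> E t <= e ^+ 2.
  move=> e0.
  have [rho1 r10 H1] := flux_energy_small a1_gt0 fW1 fX1 e0.
  have [rho2 r20 H2] := flux_energy_small a2_gt0 fW2 fX2 e0.
  exists (Num.min rho1 rho2); first by rewrite lt_min r10.
  move=> t tpq Ht.
  have m1 : Num.min rho1 rho2 <= rho1 by rewrite ge_min lexx.
  have m2 : Num.min rho1 rho2 <= rho2 by rewrite ge_min lexx orbT.
  have {}H1 : 0 <= V1 t <= e.
    by apply: H1 => //; case/orP: Ht => Ht; apply/orP; [left|right]; lra.
  have {}H2 : 0 <= V2 t <= e.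
    by apply: H2 => //; case/orP: Ht => Ht; apply/orP; [left|right]; lra.
  rewrite -[E t]/(D t * D t) -expr2 -real_normK ?num_real//
    ler_sqr ?nnegrE ?(ltW e0)//.
  by rewrite /D /= ler_norml; lra.
have key (e : R) : 0 < e -> E r <= e ^+ 2.
  move=> e0; have [rho rho0 H] := Dle e e0; have /andP[pr rq] := rpq.
  move: rs; rewrite neq_lt => /orP[rs|sr].
  (* Before s, sg > 0 makes E nonincreasing, so E r is at most E t for t close to p; halving the
     minimum keeps t below both r and p + rho. *)
  - pose t := p + Num.min rho (r - p) / 2.
    have mr : Num.min rho (r - p) <= rho by rewrite ge_min lexx.
    have mp : Num.min rho (r - p) <= r - p by rewrite ge_min lexx orbT.
    have m0 : 0 < Num.min rho (r - p) by rewrite lt_min rho0 subr_gt0.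
    have [pt tr tp] : [/\ p < t, t < r & t < p + rho] by rewrite /t; split; lra.
    have tq : p < t < q by lra.
    apply: le_trans (H t tq _); last by rewrite tp.
    have HE' (u : R) : t <= u <= r -> is_derive u 1 E (dE u).
      by move=> tur; apply: HE; [lra|rewrite lt_eqF//; lra].
    suff HE0 (u : R) : t <= u <= r -> dE u <= 0.
      by have := mean_value_le tr HE' HE0; rewrite mul0r subr_le0.
    move=> tur; rewrite /dE oppr_le0 mulr_ge0 -?expr2 ?sqr_ge0//.
    have u0 : 0 < u.
      by have /andP[tu _] := tur; exact: lt_le_trans (lt_trans p_gt0 pt) tu.
    rewrite divr_ge0 ?mulr_ge0 ?exprn_ge0 ?ltW//.
    by apply: sg_gt0; lra.
  (* After s, sg < 0 makes E nondecreasing, and the comparison point moves towards q. *)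
  - pose t := q - Num.min rho (q - r) / 2.
    have mr : Num.min rho (q - r) <= rho by rewrite ge_min lexx.
    have mp : Num.min rho (q - r) <= q - r by rewrite ge_min lexx orbT.
    have m0 : 0 < Num.min rho (q - r) by rewrite lt_min rho0 subr_gt0.
    have [pt tr tp] : [/\ r < t, t < q & q - rho < t] by rewrite /t; split; lra.
    have tq : p < t < q by lra.
    apply: le_trans (H t tq _); last by rewrite tp orbT.
    have HE' (u : R) : r <= u <= t -> is_derive u 1 E (dE u).
      by move=> tur; apply: HE; [lra|rewrite gt_eqF//; lra].
    suff HE0 (u : R) : r <= u <= t -> 0 <= dE u.
      by have := mean_value_ge pt HE' HE0; rewrite mul0r subr_ge0.
    move=> tur; rewrite /dE oppr_ge0 mulr_le0_ge0 -?expr2 ?sqr_ge0//.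
    have u0 : 0 < u.
      have /andP[ru _] := tur; apply: lt_le_trans ru.
      exact: lt_trans p_gt0 pr.
    rewrite mulr_ge0_le0 ?mulr_ge0 ?(ltW M_gt0)//
      invr_le0 mulr_ge0_le0 ?exprn_ge0 ?(ltW u0)//.
    by apply/ltW/sg_lt0; lra.
apply/eqP; rewrite -subr_eq0 -[_ - _]/(D r) -normr_le0.
apply/ler_addgt0Pr => /= e e0; rewrite add0r.
rewrite -ler_sqr ?nnegrE ?normr_ge0 ?(ltW e0)// real_normK ?num_real// expr2.
exact: key.
Qed.

(** Equal energies mean equal squares; the fluxes at X1 r and X2 r have the same sign, determined by
    the side of s on which r lies. *)
Lemma scaled_flux_unique r : p < r < q -> r != s ->
  W1 (X1 r) / Num.sqrt a1 = W2 (X2 r) / Num.sqrt a2.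
Proof.
move=> rpq rs.
have sq_eq : (W1 (X1 r) / Num.sqrt a1) ^+ 2 = (W2 (X2 r) / Num.sqrt a2) ^+ 2.
  have := flux_energy_unique rpq rs; rewrite /V1 /V2 /flux_energy => H.
  by rewrite !expr_div_n !sqr_sqrtr ?ltW// !expr2 mulrC H mulrC.
have [s1 s2] : 0 <= (Num.sqrt a1)^-1 /\ 0 <= (Num.sqrt a2)^-1.
  by rewrite !invr_ge0 !sqrtr_ge0.
move: rs; rewrite neq_lt => /orP[rs|sr].
- have w1 : 0 <= W1 (X1 r) by apply: (flux_ge0 a1_gt0 fW1); rewrite fX1.
  have w2 : 0 <= W2 (X2 r) by apply: (flux_ge0 a2_gt0 fW2); rewrite fX2.
  by apply/eqP; rewrite -(@eqrXn2 _ 2) ?mulr_ge0// sq_eq.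
- have w1 : 0 <= - W1 (X1 r).
    by rewrite oppr_ge0; apply: (flux_le0 a1_gt0 fW1); rewrite fX1.
  have w2 : 0 <= - W2 (X2 r).
    by rewrite oppr_ge0; apply: (flux_le0 a2_gt0 fW2); rewrite fX2.
  apply: oppr_inj; rewrite -!mulNr; apply/eqP.
  by rewrite -(@eqrXn2 _ 2) ?mulr_ge0// !mulNr !sqrrN sq_eq.
Qed.

(** The difference Y of the scaled inverses has zero derivative off s and is continuous at s. The
    mean value theorem with s as an endpoint therefore gives Y = Y s on both sides, whether or not r
    and r' are separated by s. *)
Lemma scaled_inverse_unique r r' : p < r < q -> p < r' < q ->
  (X1 r - X1 r') / Num.sqrt a1 = (X2 r - X2 r') / Num.sqrt a2.
Proof.
pose Y := (Num.sqrt a1)^-1 *: X1 - (Num.sqrt a2)^-1 *: X2.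
have /andP[ps sq] := s_itv.
have YE t : Y t = X1 t / Num.sqrt a1 - X2 t / Num.sqrt a2.
  by rewrite (mulrC (X1 t)) (mulrC (X2 t)).
have spq : p < s < q by rewrite ps.
have cY (t : R) : p < t < q -> {for t, continuous Y}.
  move=> tpq; apply: cvgB; apply: cvgZr.
    exact: (inverse_continuous a1_gt0 fW1 fX1 tpq).
  exact: (inverse_continuous a2_gt0 fW2 fX2 tpq).
have dY (t : R) : p < t < q -> t != s -> is_derive t 1 Y 0.
  move=> tpq ts.
  have t0 : 0 < t by have /andP[+ _] := tpq; exact: lt_trans.
  have d1 := is_derive_inverse_profile a1_gt0 fW1 fX1 tpq ts.
  have d2 := is_derive_inverse_profile a2_gt0 fW2 fX2 tpq ts.
  apply: (is_derive_eq (is_deriveB (is_deriveZ _ d1) (is_deriveZ _ d2))).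
  have W10 := inverse_flux_neq0 a1_gt0 fW1 fX1 tpq ts.
  have W20 := inverse_flux_neq0 a2_gt0 fW2 fX2 tpq ts.
  (* Writing a as the square of its root shows that X'/sqrt a depends on the profile only through
     W/sqrt a. *)
  have sa (a w : R) : 0 < a -> w != 0 ->
      (Num.sqrt a)^-1 * (a * sg t / (w * t)) = sg t / (w / Num.sqrt a * t).
    move=> a0 w0; rewrite -{2}(sqr_sqrtr (ltW a0)); field.
    by rewrite w0 !gt_eqF// sqrtr_gt0.
  by rewrite /GRing.scale /= !sa// scaled_flux_unique// subrr.
suff Ys t : p < t < q -> Y t = Y s.
  move=> rpq r'pq; have := Ys _ rpq; rewrite -(Ys _ r'pq) !YE !mulrBl; lra.
move=> tpq; have [ts|st|->//] := ltgtP t s.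
- have [u tus|u tus|c _] := @mean_value _ Y (cst 0) t s ts.
  + by apply: cY; lra.
  + by apply: dY; [lra|rewrite lt_eqF//; lra].
  + by rewrite /= mul0r; lra.
- have [u tus|u tus|c _] := @mean_value _ Y (cst 0) s t st.
  + by apply: cY; lra.
  + by apply: dY; [lra|rewrite gt_eqF//; lra].
  + by rewrite /= mul0r; lra.
Qed.

End TwoProfiles.
End WeakProfile.

(** * The reduced pressure *)

Section ShockCurve.
Context {R : realType} (d : shock_data R) (Rs : R).
Context (m_neq0 : mflux d != 0).
Context (Rm_gt0 : 0 < Rm d) (Rp_gt0 : 0 < Rp d).
Context (RHm : rankine_hugoniot d (Rm d) (Um d) (Em d)).
Context (RHp : rankine_hugoniot d (Rp d) (Up d) (Ep d)).
Context (pC2 : C2_on_line [set r : R | 0 < r] (pressure d)).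
Context (p''_ge0 : forall r : R, 0 < r -> 0 <= derive1n 2 (pressure d) r).
Context (sonic : sonic_density d Rs).

Lemma calS_rankine_hugoniot (r u E : R) : 0 < r -> rankine_hugoniot d r u E ->
  calS d r = 0.
Proof.
move=> r0 [/= Hm Hq Hk].
have uE : u = speed d + mflux d / r by rewrite -Hm; field; rewrite gt_eqF.
(* [e0] divides by the mass flux, which the rewriting below turns into r (u - c). *)
have uc : u - speed d != 0.
  by apply/eqP => E0; move: m_neq0; rewrite -Hm E0 mulr0 eqxx.
have eE : energy d r = specific_energy r u E.
  rewrite /energy /e0 /Acoef /specific_energy -Hk -Hq -Hm; field.
  by rewrite uc gt_eqF.
rewrite /calS /pressure eE -{1}Hq uE; field; by rewrite gt_eqF.
Qed.

Lemma is_derive_calS (r : R) : 0 < r ->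
  is_derive r 1 (calS d) (mflux d ^+ 2 / r ^+ 2 - derive1 (pressure d) r).
Proof.
move=> r0; have [dp _ _] := pC2 r0.
have d1 : is_derive r 1 (fun x : R => x^-1) (- r ^- 2 *: 1).
  by apply: is_deriveV => //; rewrite gt_eqF.
have d2 := is_deriveB (is_deriveB (is_derive_cst
  (qflux d - mflux d * speed d) r 1)
  (is_deriveZ (mflux d ^+ 2) d1)) (derivableP dp).
apply: (is_derive_eq d2); rewrite derive1E /GRing.scale /=; ring.
Qed.

Lemma derive1_calS (r : R) : 0 < r ->
  derive1 (calS d) r = mflux d ^+ 2 / r ^+ 2 - derive1 (pressure d) r.
Proof. by move=> r0; rewrite derive1E; have [_ ->] := is_derive_calS r0. Qed.

Lemma is_derive_derive1_calS (r : R) : 0 < r ->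
  is_derive r 1 (calS d) (derive1 (calS d) r).
Proof.
move=> r0; rewrite derive1E; apply/derivableP.
by have [] := is_derive_calS r0.
Qed.

Lemma continuous_derive1_calS (r : R) : 0 < r ->
  {for r, continuous (derive1 (calS d))}.
Proof.
move=> r0; have [_ dp' _] := pC2 r0.
have cG : {for r, continuous (fun x : R =>
  mflux d ^+ 2 / x ^+ 2 - derive1 (pressure d) x)}.
  apply: cvgB; last exact/differentiable_continuous/derivable1_diffP.
  apply: cvgM; first exact: cvg_cst.
  by apply: cvgV; [rewrite expf_neq0// gt_eqF|exact: exprn_continuous].
rewrite /prop_for /continuous_at derive1_calS//.
apply: cvg_trans cG; apply: near_eq_cvg; near=> x.
by rewrite derive1_calS//; near: x; exact: lt_nbhsr.
Unshelve. all: by end_near. Qed.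

(** m^2/r^2 is strictly decreasing, and p' is nondecreasing by convexity of the reduced pressure. *)
Lemma derive1_calS_lt (r1 r2 : R) : 0 < r1 -> r1 < r2 ->
  derive1 (calS d) r2 < derive1 (calS d) r1.
Proof.
move=> r10 r12; have r20 : 0 < r2 by exact: lt_trans r12.
rewrite !derive1_calS//.
have H1 : derive1 (pressure d) r1 <= derive1 (pressure d) r2.
  have dp' x : r1 <= x <= r2 ->
      is_derive x 1 (derive1 (pressure d)) (derive1n 2 (pressure d) x).
    move=> /andP[rx _]; have [|_ dp' _] := pC2 (x := x);
      first exact: lt_le_trans rx.
    by rewrite derive1nS derive1n1 derive1E; exact/derivableP.
  have := mean_value_ge (K := 0) r12 dp'; rewrite mul0r subr_ge0; apply.
  by move=> x /andP[rx _]; apply: p''_ge0; exact: lt_le_trans rx.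
have : mflux d ^+ 2 / r2 ^+ 2 < mflux d ^+ 2 / r1 ^+ 2.
  rewrite ltr_pM2l ?exprn_even_gt0// ltf_pV2 ?posrE ?exprn_gt0//.
  by rewrite ltr_sqr ?nnegrE ?ltW.
by lra.
Qed.

Lemma derive1_calS_sonic : derive1 (calS d) Rs = 0.
Proof.
have [/andP[ms _] H] := sonic; apply/H => //; exact: lt_trans ms.
Qed.

Lemma derive1_calS_gt0 (r : R) : 0 < r < Rs -> 0 < derive1 (calS d) r.
Proof. by move=> /andP[r0 rs]; rewrite -derive1_calS_sonic derive1_calS_lt. Qed.

Lemma derive1_calS_lt0 (r : R) : Rs < r -> derive1 (calS d) r < 0.
Proof.
move=> sr; rewrite -derive1_calS_sonic derive1_calS_lt//.
by have [/andP[ms _] _] := sonic; exact: lt_trans ms.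
Qed.

(** S vanishes at both end states by the Rankine-Hugoniot relations, rises up to Rs and falls after
    it; the mean value theorem is applied between r and the end state on its own side of Rs. *)
Lemma calS_gt0 (r : R) : Rm d < r < Rp d -> 0 < calS d r.
Proof.
move=> /andP[mr rp]; have [/andP[ms sp] _] := sonic.
have r0 : 0 < r by exact: lt_trans mr.
have dS := is_derive_derive1_calS.
have cS (x : R) : 0 < x -> {for x, continuous (calS d)}.
  by move=> x0; apply: is_derive_continuous (dS _ x0).
have [rs|sr] := leP r Rs.
- have Hc (x : R) : Rm d <= x <= r -> {for x, continuous (calS d)}.
    by move=> /andP[mx _]; apply: cS; exact: lt_le_trans mx.
  have Hd (x : R) : Rm d < x < r -> is_derive x 1 (calS d) (derive1 (calS d) x).
    by move=> /andP[mx _]; apply: dS; exact: lt_trans mx.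
  have [c /andP[mc cr]] := mean_value mr Hc Hd.
  rewrite (calS_rankine_hugoniot Rm_gt0 RHm) subr0 => ->.
  rewrite mulr_gt0 ?subr_gt0// derive1_calS_gt0// (lt_trans Rm_gt0 mc)/=.
  exact: lt_le_trans cr rs.
- have Hc (x : R) : r <= x <= Rp d -> {for x, continuous (calS d)}.
    by move=> /andP[rx _]; apply: cS; exact: lt_le_trans rx.
  have Hd (x : R) : r < x < Rp d -> is_derive x 1 (calS d) (derive1 (calS d) x).
    by move=> /andP[rx _]; apply: dS; exact: lt_trans rx.
  have [c /andP[rc cp]] := mean_value rp Hc Hd.
  rewrite (calS_rankine_hugoniot Rp_gt0 RHp) sub0r => E.
  rewrite -oppr_lt0 E nmulr_rlt0 ?subr_gt0// derive1_calS_lt0//.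
  exact: lt_trans rc.
Qed.

Lemma IGR_profile_classical (alpha : R) (f : R -> R) :
  0 < alpha -> IGR_profile d alpha f -> exists W,
  classical_profile (Rm d) Rs (Rp d) (mflux d ^+ 2)
    (calS d) (derive1 (calS d)) alpha f W.
Proof.
move=> a0 [f_range f_homo f_left f_right [g fg weq]].
(* An equation A + B = 0 between the two integrals is the weak derivative identity A = - B. *)
have weq' : weak_derivative
    (weak_flux (derive1 (calS d)) alpha f g)
    (flux_density (mflux d ^+ 2) (calS d) alpha f g).
  by move=> phi /weq /eqP; rewrite addr_eq0 => /eqP.
have [s_itv _] := sonic.
exact: (classical_profile_exists Rm_gt0 s_itv is_derive_derive1_calS
  continuous_derive1_calS derive1_calS_gt0 derive1_calS_lt0 derive1_calS_sonic
  calS_gt0 a0 f_range f_homo f_left f_right fg weq').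
Qed.

(** [pinv] is a right inverse on the range of f, so surjectivity onto the open interval is
    enough. *)
Lemma profile_inverseK (alpha : R) (f : R -> R) (r : R) :
  0 < alpha -> IGR_profile d alpha f -> Rm d < r < Rp d ->
  f (profile_inverse f r) = r.
Proof.
move=> a0 fP rpq; have [W fW] := IGR_profile_classical a0 fP.
have [x fx] := profile_onto fW rpq.
by apply: pinvK; rewrite inE; exists x.
Qed.

End ShockCurve.

Unset Implicit Arguments.

Theorem proposition5p2 (R : realType) (d : shock_data R) (Rs : R)
  (eosC2 : C2_on_plane [set x : R * R | 0 < x.1] (eos d))
  (m_neq0 : mflux d != 0)
  (Rm_gt0 : 0 < Rm d) (Rp_gt0 : 0 < Rp d)
  (RHm : rankine_hugoniot d (Rm d) (Um d) (Em d))
  (RHp : rankine_hugoniot d (Rp d) (Up d) (Ep d))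
  (Rm_lt_Rp : Rm d < Rp d)
  (lax : lax_inequalities d)
  (pC2 : C2_on_line [set r : R | 0 < r] (pressure d))
  (conv : convexity_A d \/ convexity_B d)
  (p''_ge0 : forall r : R, 0 < r -> 0 <= derive1n 2 (pressure d) r)
  (sonic : sonic_density d Rs)
  (p''_lip : lipschitz_near (derive1n 2 (pressure d)) Rs)
  (delta : R) (delta_gt0 : 0 < delta)
  (delta_lt : delta < (Rp d - Rm d) / 2) :
  exists2 C : R, 0 < C &
    forall (alpha : R) (f : R -> R), 0 < alpha -> IGR_profile d alpha f ->
      xi_plus d f delta - xi_minus d f delta = Num.sqrt alpha * C.
Proof.
have [s_itv _] := sonic.
have dS := is_derive_derive1_calS pC2.
have cS := continuous_derive1_calS pC2.
have sg_gt0 := derive1_calS_gt0 m_neq0 Rm_gt0 pC2 p''_ge0 sonic.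
have sg_lt0 := derive1_calS_lt0 m_neq0 Rm_gt0 pC2 p''_ge0 sonic.
have S_gt0 := calS_gt0 m_neq0 Rm_gt0 Rp_gt0 RHm RHp pC2 p''_ge0 sonic.
have M_gt0 : 0 < mflux d ^+ 2 by rewrite exprn_even_gt0.
have mpq : Rm d < Rm d + delta < Rp d by lra.
have ppq : Rm d < Rp d - delta < Rp d by lra.
(* The order of the two levels, due to [delta_lt], is what makes C positive when it is computed from
   a profile. *)
have mp : Rm d + delta < Rp d - delta by lra.
have [[a0 [f0 [a0_gt0 f0P]]]|noP] := pselect (exists (a0 : R) (f0 : R -> R),
  0 < a0 /\ IGR_profile d a0 f0); last first.
  by exists 1 => // alpha f a_gt0 fP; case: noP; exists alpha, f.
have [W0 fW0] := IGR_profile_classical m_neq0 Rm_gt0 Rp_gt0 RHm RHp pC2 p''_ge0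
  sonic a0_gt0 f0P.
have fX0 r := profile_inverseK m_neq0 Rm_gt0 Rp_gt0 RHm RHp pC2 p''_ge0 sonic
  a0_gt0 f0P (r := r).
exists ((xi_plus d f0 delta - xi_minus d f0 delta) / Num.sqrt a0).
  rewrite divr_gt0 ?sqrtr_gt0// subr_gt0.
  exact: (inverse_lt fW0 fX0).
move=> alpha f a_gt0 fP.
have [W fW] := IGR_profile_classical m_neq0 Rm_gt0 Rp_gt0 RHm RHp pC2 p''_ge0
  sonic a_gt0 fP.
have fX r := profile_inverseK m_neq0 Rm_gt0 Rp_gt0 RHm RHp pC2 p''_ge0 sonic
  a_gt0 fP (r := r).
have <- : (xi_plus d f delta - xi_minus d f delta) / Num.sqrt alpha =
          (xi_plus d f0 delta - xi_minus d f0 delta) / Num.sqrt a0.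
  exact: (scaled_inverse_unique Rm_gt0 s_itv M_gt0 dS cS sg_gt0 sg_lt0 S_gt0
    a_gt0 a0_gt0 fW fW0 fX fX0 ppq mpq).
by rewrite mulrC divfK// gt_eqF// sqrtr_gt0.
Qed.
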